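(* Let there be given Hilbert spaces $H_x$ of entire functions (indexed by a real parameter $x$), with entire functions $A_x$ (even, real on the real line) and $B_x$ (odd, real on the real line) such that the evaluators in $H_x$ are $Z_z(w)=2\,\frac{\overline{B_x(z)}A_x(w)-\overline{A_x(z)}B_x(w)}{\overline z-w}$, and such that, with a real valued function $\mu(x)$, $$\frac{d}{dx}A_x(w)-\mu(x)A_x(w)=-wB_x(w),\qquad \frac{d}{dx}B_x(w)+\mu(x)B_x(w)=wA_x(w).$$ Let $z_1,z_2,\dots$ be purely imaginary numbers with $z_i\ne z_j$ for $i\ne j$ and $z_i\neq-z_j$ for all $i,j$, whose associated evaluators in $H_x$ are linearly independent. Let $H_x(n)=H_x(z_1,\dots,z_n)$ be the modified spaces and let $\mathcal A_{x,n}$ and $\mathcal B_{x,n}$ be the associated functions computing the reproducing kernel of $H_x(n)$ that are defined in the context. Then these functions are obtained by successive transformations $$\mathcal A_{x,n+1}(w)=\frac1{z_{n+1}^2-w^2}\left(\frac{d}{dx}\mathcal A_{x,n}(w)-\frac{\frac{d}{dx}\mathcal A_{x,n}(z_{n+1})}{\mathcal A_{x,n}(z_{n+1})}\mathcal A_{x,n}(w)\right),$$ $$\mathcal B_{x,n+1}(w)=\frac1{z_{n+1}^2-w^2}\left(\frac{d}{dx}\mathcal B_{x,n}(w)-\frac{\frac{d}{dx}\mathcal B_{x,n}(z_{n+1})}{\mathcal B_{x,n}(z_{n+1})}\mathcal B_{x,n}(w)\right),$$ and verify the equations $$\frac{d}{dx}\mathcal A_{x,n}(w)-\mu_n(x)\mathcal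 A_{x,n}(w)=-w\mathcal B_{x,n}(w),\qquad \frac{d}{dx}\mathcal B_{x,n}(w)+\mu_n(x)\mathcal B_{x,n}(w)=w\mathcal A_{x,n}(w)$$ with $$\mu_n=\mu-\frac{d}{dx}\log\frac{W(A_x(z_1),\dots,A_x(z_n))}{W(B_x(z_1),\dots,B_x(z_n))}.$$ If a function $\tau$ is chosen with $\mu^2=-\frac{d^2}{dx^2}\log\tau$, then $\mu_n^2=-\frac{d^2}{dx^2}\log\tau_n$ with $$\tau_n=\tau\cdot W(A_x(z_1),\dots,A_x(z_n))\,W(-iB_x(z_1),\dots,-iB_x(z_n)).$$
   Context: Scalar products are conjugate linear in the first factor. For a Hilbert space $H$ of entire functions with continuous evaluations, the evaluator $Z_z\in H$ is the vector with $f(z)=(Z_z,f)$ for all $f\in H$. With $\gamma_n(w)=\prod_{1\le i\le n}\frac1{w-z_i}$, the modified space is $H_x(n)=\{\gamma_nf:f\in H_x,\ f(z_1)=\dots=f(z_n)=0\}$, normed so that $f\mapsto\gamma_nf$ is an isometry. $W(f_1,\dots,f_m)=\det(f_j^{(i-1)})_{1\le i,j\le m}$ is the Wronskian with respect to $x$; $\frac{d}{dx}\log f$ means $f'/f$. Functions of $x$ are tacitly assumed smooth enough for the expressions to make sense. Definition of $\mathcal A_{x,n},\mathcal B_{x,n}$ ($n\ge1$): with $\gamma_n^*(w)=\overline{\gamma_n(\overline w)}$, $$\mathcal A_{x,n}(w)=(-1)^{\frac{n(n-1)}2}\gamma_n(w)\gamma_n^*(w)\frac{D^A_{n+1}(z_1,\dots,z_n,w)}{D^A_n(z_1,\dots,z_n)},\quad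 \mathcal B_{x,n}(w)=(-1)^{\frac{n(n+1)}2}\gamma_n(w)\gamma_n^*(w)\frac{D^B_{n+1}(z_1,\dots,z_n,w)}{D^B_n(z_1,\dots,z_n)},$$ where $D^A_m(\zeta_1,\dots,\zeta_m)$ is the $m\times m$ determinant whose $k$-th row has entries $\zeta_j^{k-1}A_x(\zeta_j)$ for $k$ odd and $\zeta_j^{k-1}B_x(\zeta_j)$ for $k$ even ($1\le j\le m$), and $D^B_m$ is the same with $A_x$ and $B_x$ exchanged. For $n=0$, $\mathcal A_{x,0}=A_x$, $\mathcal B_{x,0}=B_x$, $\mu_0=\mu$. The reproducing kernel of $H_x(n)$ is $2\,\frac{\overline{\mathcal B_{x,n}(z)}\mathcal A_{x,n}(w)-\overline{\mathcal A_{x,n}(z)}\mathcal B_{x,n}(w)}{\overline z-w}$. *)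

(* Defs.v *)
From HB Require Import structures.
From mathcomp Require Import all_boot all_order all_algebra.
From mathcomp Require Import all_classical all_reals all_analysis.
From mathcomp Require Import complex.

Set Implicit Arguments.
Unset Strict Implicit.
Unset Printing Implicit Defensive.

Import Order.TTheory GRing.Theory Num.Theory.
Import numFieldNormedType.Exports.
Local Open Scope classical_set_scope.
Local Open Scope complex_scope.
Local Open Scope ring_scope.

Definition entire (R : realType) (f : R[i] -> R[i]) : Prop :=
  forall w : R[i], derivable (f : R[i]^o -> R[i]^o) (w : R[i]^o) (1 : R[i]^o).

Definition real_on_real (R : realType) (f : R[i] -> R[i]) : Prop :=
  forall t : R, complex.Im (f t%:C) = 0.

(* A Hilbert space whose vectors are entire functions (vector operations are
   pointwise) and whose evaluations are continuous. The values of [he_ip]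
   outside [he_mem] are irrelevant. *)
Record hilbert_entire (R : realType) := HilbertEntire {
  he_mem : set (R[i] -> R[i]);
  he_ip : (R[i] -> R[i]) -> (R[i] -> R[i]) -> R[i];
  he_norm : (R[i] -> R[i]) -> R := fun f => Num.sqrt (complex.Re (he_ip f f));
  he_dist : (R[i] -> R[i]) -> (R[i] -> R[i]) -> R :=
    fun f g => he_norm (fun w => f w - g w);
  he_entire : forall f, he_mem f -> entire f;
  he_mem0 : he_mem (fun=> 0);
  he_memP : forall (a : R[i]) f g, he_mem f -> he_mem g ->
    he_mem (fun w => a * f w + g w);
  he_ip_linear : forall (a : R[i]) h f g, he_mem h -> he_mem f -> he_mem g ->
    he_ip h (fun w => a * f w + g w) = a * he_ip h f + he_ip h g;
  he_ip_conj : forall f g, he_mem f -> he_mem g -> he_ip g f = (he_ip f g)^*;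
  he_ip_ge0 : forall f, he_mem f -> 0 <= he_ip f f;
  he_ip_eq0 : forall f, he_mem f -> he_ip f f = 0 -> f = fun=> 0;
  he_complete : forall u : nat -> R[i] -> R[i],
    (forall k, he_mem (u k)) ->
    (forall e : R, 0 < e -> exists N : nat, forall j k : nat,
       (N <= j)%N -> (N <= k)%N -> he_dist (u j) (u k) < e) ->
    exists2 f, he_mem f &
      forall e : R, 0 < e -> exists N : nat, forall k : nat,
        (N <= k)%N -> he_dist (u k) f < e;
  he_eval_continuous : forall (z : R[i]) f, he_mem f ->
    forall e : R, 0 < e -> exists2 d : R, 0 < d &
      forall g, he_mem g -> he_dist g f < d -> `|g z - f z| < e%:C
}.

Definition is_evaluator (R : realType) (H : hilbert_entire R) (z : R[i])
    (Z : R[i] -> R[i]) : Prop :=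
  he_mem H Z /\ forall f, he_mem H f -> f z = he_ip H Z f.

Definition lin_indep (R : realType) (F : nat -> R[i] -> R[i]) : Prop :=
  forall (n : nat) (c : 'I_n -> R[i]),
    (forall w, \sum_(i < n) c i * F i w = 0) -> forall i, c i = 0.

(* Derivative with respect to a real variable of a complex-valued function. *)
Definition cderivable (R : realType) (f : R -> R[i]) (x : R) : Prop :=
  derivable (fun t => complex.Re (f t)) x 1 /\
  derivable (fun t => complex.Im (f t)) x 1.

Definition cderive (R : realType) (f : R -> R[i]) (x : R) : R[i] :=
  derive1 (fun t => complex.Re (f t)) x +i*
  derive1 (fun t => complex.Im (f t)) x.

Definition dlog (R : realType) (f : R -> R[i]) (x : R) : R[i] :=
  cderive f x / f x.

(* g = - (d/dx)^2 log tau on U, including that this makes sense. *)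
Definition is_neg_dlog2 (R : realType) (U : set R) (tau g : R -> R[i]) : Prop :=
  forall x, U x ->
    [/\ tau x <> 0, cderivable tau x, cderivable (dlog tau) x
      & g x = - cderive (dlog tau) x].

Definition wronskian (R : realType) (n : nat) (f : 'I_n -> R -> R[i]) (x : R) :
    R[i] :=
  \det (\matrix_(i < n, j < n) iter i (@cderive R) (f j) x).

Definition first_order_system (R : realType) (U : set R) (mu : R -> R[i])
    (A B : R -> R[i] -> R[i]) : Prop :=
  forall x, U x -> forall w : R[i],
    [/\ cderivable (fun t => A t w) x,
        cderivable (fun t => B t w) x,
        cderive (fun t => A t w) x - mu x * A x w = - w * B x w
      & cderive (fun t => B t w) x + mu x * B x w = w * A x w].

(* With rows k = 1, ..., m: the k-th row is zeta_j^(k-1) E(zeta_j) for k odd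
   and zeta_j^(k-1) F(zeta_j) for k even. *)
Definition altdet (R : realType) (E F : R[i] -> R[i]) (m : nat)
    (zeta : 'I_m -> R[i]) : R[i] :=
  \det (\matrix_(k < m, j < m)
          (zeta j ^+ k * (if odd k then F (zeta j) else E (zeta j)))).

(* The sequence of points z_1, z_2, ... is z 0, z 1, ... *)
Definition gamma (R : realType) (z : nat -> R[i]) (n : nat) (w : R[i]) : R[i] :=
  \prod_(i < n) (w - z i)^-1.

Definition gamma_star (R : realType) (z : nat -> R[i]) (n : nat) (w : R[i]) :
    R[i] :=
  (gamma z n w^*)^*.

Definition altdet_ratio (R : realType) (z : nat -> R[i]) (n : nat)
    (E F : R[i] -> R[i]) (w : R[i]) : R[i] :=
  gamma z n w * gamma_star z n w *
  (altdet E F (fun j : 'I_n.+1 => if (j < n)%N then z j else w)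
   / altdet E F (fun j : 'I_n => z j)).

Definition extend (R : realType) (g : R[i] -> R[i]) (w : R[i]) : R[i] :=
  lim ((g : R[i]^o -> R[i]^o) v @[v --> (w : R[i]^o)^']).

(* For n >= 1 the defining quotient has removable singularities at z_i and
   conj z_i (i <= n); the punctured limit is the value at w of the entire
   function that it defines, at every w. *)
Definition calA (R : realType) (z : nat -> R[i]) (A B : R -> R[i] -> R[i])
    (n : nat) (x : R) (w : R[i]) : R[i] :=
  if n is 0 then A x w else
  extend (fun v => (-1) ^+ (n * (n - 1))./2 * altdet_ratio z n (A x) (B x) v) w.

Definition calB (R : realType) (z : nat -> R[i]) (A B : R -> R[i] -> R[i])
    (n : nat) (x : R) (w : R[i]) : R[i] :=
  if n is 0 then B x w else
  extend (fun v => (-1) ^+ (n * (n + 1))./2 * altdet_ratio z n (B x) (A x) v) w.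

(* W(A_x(z_1), ..., A_x(z_n)) as a function of x. *)
Definition Wz (R : realType) (z : nat -> R[i]) (A : R -> R[i] -> R[i])
    (n : nat) : R -> R[i] :=
  wronskian (fun (j : 'I_n) t => A t (z j)).

Definition mu_n (R : realType) (z : nat -> R[i]) (A B : R -> R[i] -> R[i])
    (mu : R -> R) (n : nat) (x : R) : R[i] :=
  (mu x)%:C - dlog (fun t => Wz z A n t / Wz z B n t) x.

Definition tau_n (R : realType) (z : nat -> R[i]) (A B : R -> R[i] -> R[i])
    (tau : R -> R[i]) (n : nat) (x : R) : R[i] :=
  tau x * Wz z A n x * Wz z (fun t w => - 'i%C * B t w) n x.

(* Main.v *)
Require Import Defs.
From mathcomp Require Import all_boot all_order all_algebra.
From mathcomp Require Import all_classical all_reals all_analysis.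
From mathcomp Require Import complex qpoly ring lra.
Set Implicit Arguments.
Unset Strict Implicit.
Unset Printing Implicit Defensive.
Import Order.TTheory GRing.Theory Num.Theory.
Import numFieldNormedType.Exports.
Local Open Scope classical_set_scope.
Local Open Scope complex_scope.
Local Open Scope ring_scope.

(** Fix the parameter [x]. Up to sign and the factor
    [gamma * gamma_star = \prod_i (w^2 - z_i^2)^-1], the function
    [calA n x w] is the quotient of determinants [D_{n+1}(z, w) / D_n(z)],
    which is the unique combination
    [w^n E_n(w) + \sum_(k < n) c_k w^k E_k(w)], with [E_k] equal to [A] for
    even [k] and to [B] for odd [k], that vanishes at [z_1], ..., [z_n];
    [calB] is the same with [A] and [B] exchanged. Uniqueness needs
    [D_n <> 0]. A linear relation between the rows of [D_n] is a function
    [P A + Q B] with polynomials [P], [Q] of degree less than [n] that vanishes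
    at all the [z_j] and [- z_j]; its partial fraction expansion is a
    combination of evaluators orthogonal to each of them, so that the
    independence of the evaluators excludes it
    ([polynomial_combination_eq0], [altdet_AB_neq0], [altdet_BA_neq0]).

    Uniqueness gives the recursion in [n]: [w] times the combination of [calB],
    corrected by a multiple of the one of [calA] so as to vanish at the new
    node, is the next combination for [calA] ([altpolyS], [regularizedS]).
    Suppose that [(calA n, calB n)] solves the system with potential [m]. Then
    this recursion is the stated one with logarithmic derivatives, and it is a
    Darboux transformation: its result solves the system again, with potential
    [m - dlog (a / b)] where [a], [b] are the values at the new node
    ([darboux_step], [dlog_solution_ratio]). The new functions have removable
    singularities at the node, where the system is obtained by letting [w] tend
    to it; a Gronwall estimate uniform in [w] makes this possible
    ([system_limit]).

    It remains to recognize the accumulated potential. Differentiating the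
    system [k] times expresses the [k]-th derivative of [A_x(w)] through
    [w^l E_l(w)], [l <= k], with coefficients free of [w] and a constant
    leading one, so that the Wronskians are constant multiples of the
    determinants [D_n] ([wronskian_altdet]), and these are, up to constants,
    the products of the values of the [calA k] at their nodes. Hence the
    logarithmic derivatives telescope to [mu_n] ([Wz_quotient]), and at each
    step the formula for [tau_n] reduces to completing a square
    ([is_neg_dlog2_darboux]). *)

(** * Derivatives of complex functions of a real variable *)
Section RealDerivative.
Variable R : realType.
Implicit Types (f g : R -> R) (x a b : R).

Lemma real_is_deriveD f g x a b : is_derive x 1 f a -> is_derive x 1 g b ->
  is_derive x 1 (fun t => f t + g t) (a + b).
Proof. move=> df dg; exact: (is_deriveD df dg). Qed.

Lemma real_is_deriveN f x a : is_derive x 1 f a ->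
  is_derive x 1 (fun t => - f t) (- a).
Proof. move=> df; exact: (is_deriveN df). Qed.

Lemma real_is_deriveM f g x a b : is_derive x 1 f a -> is_derive x 1 g b ->
  is_derive x 1 (fun t => f t * g t) (a * g x + f x * b).
Proof.
move=> df dg; rewrite [a * _]mulrC addrC.
exact: (is_deriveM df dg).
Qed.

Lemma real_is_deriveV f x a : f x != 0 -> is_derive x 1 f a ->
  is_derive x 1 (fun t => (f t)^-1) (- a / f x ^+ 2).
Proof.
move=> fx0 [df <-]; split; first exact: (derivableV fx0 df).
by rewrite (deriveV fx0 df) mulNr mulrC -mulNr.
Qed.

End RealDerivative.

(** The relational form of [cderive], in which differentiability and the value
of the derivative travel together. *)
Definition has_cderive (R : realType) (f : R -> R[i]) (x : R) (d : R[i]) :=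
  cderivable f x /\ cderive f x = d.

Section ComplexDerivative.
Variable R : realType.
Implicit Types (f g : R -> R[i]) (x : R) (c d : R[i]) (U : set R).

Lemma has_cderiveP f x d :
  has_cderive f x d <->
  is_derive x 1 (fun t => complex.Re (f t)) (complex.Re d) /\
  is_derive x 1 (fun t => complex.Im (f t)) (complex.Im d).
Proof.
split.
- case=> -[dr di] <-; rewrite /cderive !derive1E.
  split; [exact: (DeriveDef dr) | exact: (DeriveDef di)].
- case=> -[dr er] [di ei]; split; first exact: (conj dr di).
  by rewrite /cderive !derive1E er ei; clear; case: d.
Qed.

Lemma has_cderive_cst x c : has_cderive (fun=> c) x 0.
Proof. by apply/has_cderiveP; split; exact: is_derive_cst. Qed.

Lemma has_cderive_id x : has_cderive (fun t => t%:C) x 1.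
Proof.
by apply/has_cderiveP; split; [exact: is_derive_id|exact: is_derive_cst].
Qed.

Lemma has_cderiveD f g x d e :
  has_cderive f x d -> has_cderive g x e ->
  has_cderive (fun t => f t + g t) x (d + e).
Proof.
move=> /has_cderiveP[fr fi] /has_cderiveP[gr gi]; apply/has_cderiveP.
under eq_fun do rewrite raddfD.
under [X in _ /\ is_derive _ _ X _]eq_fun do rewrite raddfD.
rewrite !raddfD.
split; [exact: (real_is_deriveD fr gr) | exact: (real_is_deriveD fi gi)].
Qed.

Lemma has_cderiveM f g x d e :
  has_cderive f x d -> has_cderive g x e ->
  has_cderive (fun t => f t * g t) x (d * g x + f x * e).
Proof.
move=> /has_cderiveP[fr fi] /has_cderiveP[gr gi]; apply/has_cderiveP.
have ReM (u v : R[i]) : complex.Re (u * v) =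
  complex.Re u * complex.Re v + - (complex.Im u * complex.Im v).
  by case: u v => ? ? [].
have ImM (u v : R[i]) : complex.Im (u * v) =
  complex.Re u * complex.Im v + complex.Im u * complex.Re v.
  by case: u v => ? ? [].
under eq_fun do rewrite ReM.
under [X in _ /\ is_derive _ _ X _]eq_fun do rewrite ImM.
have := real_is_deriveD (real_is_deriveM fr gr)
                        (real_is_deriveN (real_is_deriveM fi gi)).
have := real_is_deriveD (real_is_deriveM fr gi) (real_is_deriveM fi gr).
rewrite !raddfD /= !ReM !ImM => hi hr; split.
  by move: hr; congr is_derive; ring.
by move: hi; congr is_derive; ring.
Qed.

Lemma has_cderiveV f x d : f x <> 0 ->
  has_cderive f x d -> has_cderive (fun t => (f t)^-1) x (- d / f x ^+ 2).
Proof.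
move=> fx0 /has_cderiveP[fr fi]; apply/has_cderiveP.
have dn := real_is_deriveD (real_is_deriveM fr fr) (real_is_deriveM fi fi).
set n := fun t => _ + _ in dn.
have nx0 : n x != 0.
  apply/eqP => nx; apply: fx0; move: nx; rewrite /n.
  case: (f x) => a b /= h; apply/eqP; rewrite eq_complex /=.
  have := sqr_ge0 a; have := sqr_ge0 b; rewrite !expr2 => hb ha.
  have a0 : a * a = 0 by lra.
  have b0 : b * b = 0 by lra.
  by move: a0 b0 => /eqP; rewrite mulf_eq0 orbb => -> /eqP; rewrite mulf_eq0 orbb.
have dV := real_is_deriveV nx0 dn.
have ReV (u : R[i]) : complex.Re u^-1 = complex.Re u *
   (complex.Re u * complex.Re u + complex.Im u * complex.Im u)^-1.
  by case: u => ? ?; rewrite -!expr2.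
have ImV (u : R[i]) : complex.Im u^-1 = - (complex.Im u *
   (complex.Re u * complex.Re u + complex.Im u * complex.Im u)^-1).
  by case: u => ? ?; rewrite -!expr2.
under eq_fun do rewrite ReV.
under [X in _ /\ is_derive _ _ X _]eq_fun do rewrite ImV.
have hr := real_is_deriveM fr dV.
have hi := real_is_deriveN (real_is_deriveM fi dV).
have E : - d / f x ^+ 2 =
    (- (n x) ^- 2 *
     (complex.Re d * (complex.Re (f x) ^+ 2 - complex.Im (f x) ^+ 2)
        + 2 * complex.Im d * complex.Re (f x) * complex.Im (f x))) +i*
    (- (n x) ^- 2 *
      (complex.Im d * (complex.Re (f x) ^+ 2 - complex.Im (f x) ^+ 2)
        - 2 * complex.Re d * complex.Re (f x) * complex.Im (f x))).
  apply: (canLR (mulfK _)); first by rewrite expf_neq0 //; apply/eqP.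
  move: nx0; rewrite /n; clear; case: (f x) d => a b [a' b'] /= nx0.
  by apply/eqP; rewrite expr2 eq_complex /=; apply/andP; split;
    apply/eqP; field.
rewrite E /=; split; [move: hr | move: hi]; congr is_derive;
  move: nx0; rewrite /n => nx0; field.
all: exact: nx0.
Qed.

Lemma has_cderiveZ f x c d : has_cderive f x d ->
  has_cderive (fun t => c * f t) x (c * d).
Proof.
by move=> /(has_cderiveM (has_cderive_cst x c)); rewrite mul0r add0r.
Qed.

Lemma has_cderiveN f x d : has_cderive f x d ->
  has_cderive (fun t => - f t) x (- d).
Proof.
move=> /(has_cderiveZ (-1)); rewrite mulN1r.
by under eq_fun do rewrite mulN1r.
Qed.

Lemma has_cderiveB f g x d e :
  has_cderive f x d -> has_cderive g x e ->
  has_cderive (fun t => f t - g t) x (d - e).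
Proof. by move=> hf /has_cderiveN; exact: has_cderiveD. Qed.

Lemma has_cderive_div f g x d e : g x <> 0 ->
  has_cderive f x d -> has_cderive g x e ->
  has_cderive (fun t => f t / g t) x ((d * g x - f x * e) / g x ^+ 2).
Proof.
move=> gx0 hf /(has_cderiveV gx0)/(has_cderiveM hf).
by congr has_cderive; field; apply/eqP.
Qed.

Lemma cderivable_real (f : R -> R) x : derivable f x 1 ->
  cderivable (fun t => (f t)%:C) x.
Proof. move=> df; exact: (conj df (derivable_cst _ _ _)). Qed.

(** Differentiating an identity that holds on an open set only; the functions
of the theorem are unrelated outside [U]. *)
Lemma has_cderive_ext U f g x d : open U -> U x ->
  (forall t, U t -> f t = g t) -> has_cderive f x d -> has_cderive g x d.
Proof.
move=> oU Ux fg /has_cderiveP[fr fi]; apply/has_cderiveP.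
have nU : \forall t \near x, U t by exact: open_nbhs_nbhs.
split.
  by apply: near_eq_is_derive fr; near=> t; rewrite fg //; near: t.
by apply: near_eq_is_derive fi; near=> t; rewrite fg //; near: t.
Unshelve. all: by end_near. Qed.

Lemma cderivable_has f x : cderivable f x -> has_cderive f x (cderive f x).
Proof. by []. Qed.

End ComplexDerivative.

(** * Mean value estimates *)

(** The l1 norm on the complex numbers: it is real-valued and built from the
components, as [cderive] is, so that real mean value theorems apply to it. *)
Definition norm1 (R : realType) (u : R[i]) : R :=
  `|complex.Re u| + `|complex.Im u|.

Section Norm1.
Variable R : realType.
Implicit Types (u v : R[i]).

Lemma norm1_ge0 u : 0 <= norm1 u.
Proof. by rewrite addr_ge0. Qed.

Lemma norm1D u v : norm1 (u + v) <= norm1 u + norm1 v.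
Proof.
rewrite /norm1 !raddfD /= addrACA; apply: lerD; exact: ler_normD.
Qed.

Lemma norm1N u : norm1 (- u) = norm1 u.
Proof. by rewrite /norm1 !raddfN /= !normrN. Qed.

Lemma norm1B u v : norm1 (u - v) <= norm1 u + norm1 v.
Proof. by rewrite -[norm1 v]norm1N norm1D. Qed.

Lemma norm1M u v : norm1 (u * v) <= norm1 u * norm1 v.
Proof.
case: u v => a b [c d]; rewrite /norm1 /=.
have := ler_normB (a * c) (b * d); have := ler_normD (a * d) (b * c).
rewrite !normrM; lra.
Qed.

Lemma norm1_le_normc u : ((norm1 u)%:C <= 2 * `|u|)%R.
Proof.
rewrite /norm1 raddfD /= mulr2n mulrDl !mul1r lerD ?normc_ge_Re //.
have -> : `|u| = `|u * 'i%C|.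
  by case: u => a b; rewrite !normc_def /=; congr (Num.sqrt _)%:C; ring.
by rewrite -[X in X%:C]normrN -ReiNIm normc_ge_Re.
Qed.

End Norm1.

Section MeanValue.
Variable R : realType.

Lemma two_sided_MVT (f df : R -> R) (x x0 : R) :
  (forall t, `|t - x0| <= `|x - x0| -> is_derive t 1 f (df t)) ->
  exists2 c, `|c - x0| <= `|x - x0| & f x - f x0 = df c * (x - x0).
Proof.
move=> fd.
have within (p q : R) : (forall t, t \in `[p, q] -> `|t - x0| <= `|x - x0|) ->
    {within `[p, q], continuous f}.
  move=> pq; apply: derivable_within_continuous => t tpq.
  by case: (fd t (pq _ tpq)).
have [xx0|xx0] := leP x0 x.
  have E t : t \in `[x0, x] -> `|t - x0| <= `|x - x0|.
    by rewrite in_itv /= => /andP[? ?]; rewrite !ger0_norm; lra.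
  have [|c cI fE] := @MVT_segment R f df x0 x xx0 _ (within _ _ E).
    by move=> t /subset_itv_oo_cc tI; apply: fd; exact: E.
  by exists c => //; exact: E.
have E t : t \in `[x, x0] -> `|t - x0| <= `|x - x0|.
  by rewrite in_itv /= => /andP[? ?]; rewrite !ler0_norm; lra.
have [|c cI fE] := @MVT_segment R f df x x0 (ltW xx0) _ (within _ _ E).
  by move=> t /subset_itv_oo_cc tI; apply: fd; exact: E.
exists c; first exact: E.
by rewrite -opprB fE; ring.
Qed.

(** The two components are bounded separately, whence the factor 2. *)
Lemma norm1_mean_value (f df : R -> R[i]) (x x0 M : R) :
  (forall t, `|t - x0| <= `|x - x0| ->
     has_cderive f t (df t) /\ norm1 (df t) <= M) ->
  norm1 (f x - f x0) <= 2 * M * `|x - x0|.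
Proof.
move=> fd.
have [t /fd[/has_cderiveP[dr _] _]|c cI Er] :=
  @two_sided_MVT (fun t => complex.Re (f t)) (fun t => complex.Re (df t)) x x0.
  exact: dr.
have [t /fd[/has_cderiveP[_ di] _]|d dI Ei] :=
  @two_sided_MVT (fun t => complex.Im (f t)) (fun t => complex.Im (df t)) x x0.
  exact: di.
rewrite /norm1 !raddfB /= Er Ei !normrM -mulrDl ler_wpM2r //.
have [_ hc] := fd _ cI; have [_ hd] := fd _ dI; move: hc hd; rewrite /norm1.
have := normr_ge0 (complex.Im (df c)); have := normr_ge0 (complex.Re (df d)).
lra.
Qed.

Lemma linear_approx_is_derive (f : R -> R) (x l : R) :
  (forall e, 0 < e -> exists2 d, 0 < d & forall t, `|t - x| < d ->
     `|f t - f x - (t - x) * l| <= e * `|t - x|) ->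
  is_derive x 1 f l.
Proof.
move=> fl.
have cv : (fun h : R => h^-1 *: (f (h *: 1 + x) - f x)) @ 0^' --> l.
  apply/cvgrPdist_le => e e0; have [d d0 fd] := fl e e0.
  near=> h.
  have h0 : h != 0 by near: h; exact: nbhs_dnbhs_neq.
  have hd : `|h| < d.
    near: h; apply: dnbhs0_lt; exact: d0.
  have := fd (h *: 1 + x).
  rewrite addrK /GRing.scale /= mulr1 => /(_ hd) H.
  have -> : l - h^-1 * (f (h + x) - f x) =
    - (h^-1 * (f (h + x) - f x - h * l)) by field.
  rewrite normrN normrM normfV mulrC ler_pdivrMr ?normr_gt0 //.
apply: DeriveDef; first by apply/cvg_ex; exists l.
exact: cvg_lim cv.
Unshelve. all: by end_near. Qed.

End MeanValue.

(** * Limits of solutions of the first-order system *)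
Section Gronwall.
Variable R : realType.

(** A Gronwall bound, uniform in the parameter [w] as long as [norm1 w <= K].
Let [G] be the maximum of [norm1 a + norm1 b] on the interval. The system
bounds both derivatives by [K * G], so that [G] exceeds the value at [x0] by
at most [4 * K * G * d <= G / 2]. *)
Lemma system_bounded (x0 d K : R) (m : R -> R[i]) (w : R[i]) (a b : R -> R[i]) :
  0 <= d -> 0 <= K -> 8 * K * d <= 1 ->
  (forall t, `|t - x0| <= d -> norm1 (m t) <= K) -> norm1 w <= K ->
  (forall t, `|t - x0| <= d -> has_cderive a t (m t * a t - w * b t)) ->
  (forall t, `|t - x0| <= d -> has_cderive b t (- (m t * b t) + w * a t)) ->
  forall t, `|t - x0| <= d ->
    norm1 (a t) + norm1 (b t) <= 2 * (norm1 (a x0) + norm1 (b x0)).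
Proof.
move=> d0 K0 Kd mK wK da db.
pose G t := norm1 (a t) + norm1 (b t).
have itv t : (t \in `[x0 - d, x0 + d]) = (`|t - x0| <= d).
  by rewrite in_itv /= ler_distl.
have cR (f : R -> R) : (forall t, `|t - x0| <= d -> derivable f t 1) ->
    {within `[x0 - d, x0 + d], continuous (fun t => `|f t|)}.
  move=> df; have cf : {within `[x0 - d, x0 + d], continuous f}.
    by apply: derivable_within_continuous => t; rewrite itv; exact: df.
  by move=> t; apply: cvg_norm; exact: cf.
have cG : {within `[x0 - d, x0 + d], continuous G}.
  move=> t; apply: cvgD; apply: cvgD; apply: cR => {}t tI.
  - by have /has_cderiveP[[]] := da _ tI.
  - by have /has_cderiveP[_ []] := da _ tI.
  - by have /has_cderiveP[[]] := db _ tI.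
  - by have /has_cderiveP[_ []] := db _ tI.
have [|c] := EVT_max _ cG; first lra.
rewrite itv => cI Gmax.
have G0 t : 0 <= G t by rewrite addr_ge0 ?norm1_ge0.
have bound (f g : R -> R[i]) (s : R[i]) : norm1 s <= K ->
    (forall t, `|t - x0| <= d -> norm1 (f t) + norm1 (g t) <= G c) ->
    forall t (p : R[i]), `|t - x0| <= d -> norm1 p <= K ->
    norm1 (p * f t + s * g t) <= K * G c.
  move=> sK fg t p tI pK; apply: le_trans (norm1D _ _) _.
  have h1 := norm1M p (f t); have h2 := norm1M s (g t).
  have h3 : norm1 p * norm1 (f t) <= K * norm1 (f t).
    by rewrite ler_wpM2r ?norm1_ge0.
  have h4 : norm1 s * norm1 (g t) <= K * norm1 (g t).
    by rewrite ler_wpM2r ?norm1_ge0.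
  have h5 : K * (norm1 (f t) + norm1 (g t)) <= K * G c.
    by rewrite ler_wpM2l ?fg.
  lra.
have Gle t : `|t - x0| <= d -> norm1 (a t) + norm1 (b t) <= G c.
  by move=> tI; apply: Gmax; rewrite itv.
have Gle' t : `|t - x0| <= d -> norm1 (b t) + norm1 (a t) <= G c.
  by move=> tI; rewrite addrC; exact: Gle.
have step (f df : R -> R[i]) :
    (forall t, `|t - x0| <= d -> has_cderive f t (df t)) ->
    (forall t, `|t - x0| <= d -> norm1 (df t) <= K * G c) ->
    norm1 (f c) <= norm1 (f x0) + 2 * (K * G c) * d.
  move=> fd fb.
  have : norm1 (f c - f x0) <= 2 * (K * G c) * `|c - x0|.
    apply: (@norm1_mean_value _ f df) => t tc.
    have tI : `|t - x0| <= d by exact: le_trans tc cI.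
    by split; [exact: fd|exact: fb].
  have : 2 * (K * G c) * `|c - x0| <= 2 * (K * G c) * d.
    by rewrite ler_wpM2l // !mulr_ge0.
  have -> : f c = f x0 + (f c - f x0) by ring.
  have := norm1D (f x0) (f c - f x0).
  have -> : f x0 + (f c - f x0) - f x0 = f c - f x0 by ring.
  lra.
have sa := step _ _ da; have sb := step _ _ db.
have {}sa : norm1 (a c) <= norm1 (a x0) + 2 * (K * G c) * d.
  apply: sa => t tI; rewrite -mulNr; apply: bound => //; last exact: mK.
  by rewrite norm1N.
have {}sb : norm1 (b c) <= norm1 (b x0) + 2 * (K * G c) * d.
  apply: sb => t tI; rewrite -mulNr; apply: bound => //.
  by rewrite norm1N; exact: mK.
have h : 8 * K * d * G c <= 1 * G c by rewrite ler_wpM2r.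
have Gc : G c <= 2 * (norm1 (a x0) + norm1 (b x0)).
  by move: h sa sb; rewrite /G; lra.
by move=> t /Gle tI; exact: le_trans tI Gc.
Qed.

End Gronwall.

Section Limits.
Context {R : realType} {T : Type} {F : set_system T} {FF : ProperFilter F}.

Definition cvg1 (f : T -> R[i]) (l : R[i]) : Prop :=
  forall e : R, 0 < e -> \forall i \near F, norm1 (f i - l) < e.

Lemma cvg1_bounded f l : cvg1 f l -> \forall i \near F, norm1 (f i) < norm1 l + 1.
Proof.
move=> /(_ 1 ltr01); apply: filterS => i h.
rewrite -[f i](subrK l) addrC.
have := norm1D l (f i - l); lra.
Qed.

Lemma norm1_le_lim (f : T -> R[i]) (l : R[i]) (M : R) :
  cvg1 f l -> (\forall i \near F, norm1 (f i) <= M) -> norm1 l <= M.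
Proof.
move=> fl fM; apply/ler_addgt0Pl => e e0.
have [i [h1 h2]] := filter_ex (filterI (fl _ e0) fM).
have -> : l = f i - (f i - l) by ring.
have := norm1B (f i) (f i - l); lra.
Qed.

Lemma cvg1_cst c : cvg1 (fun=> c) c.
Proof.
move=> e e0; apply: nearW => i.
by rewrite subrr /norm1 /= normr0 addr0.
Qed.

Lemma cvg1D f g k l : cvg1 f k -> cvg1 g l -> cvg1 (fun i => f i + g i) (k + l).
Proof.
move=> fk gl e e0; have e20 : 0 < e / 2 by lra.
apply: filterS2 (fk _ e20) (gl _ e20) => i.
have -> : f i + g i - (k + l) = (f i - k) + (g i - l) by ring.
have := norm1D (f i - k) (g i - l); lra.
Qed.

Lemma cvg1Z c f l : cvg1 f l -> cvg1 (fun i => c * f i) (c * l).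
Proof.
move=> fl e e0.
have c0 : 0 < norm1 c + 1 by rewrite ltr_pwDr // norm1_ge0.
have e20 : 0 < e / (norm1 c + 1) by rewrite divr_gt0.
apply: filterS (fl _ e20) => i; rewrite -mulrBr ltr_pdivlMr // => h.
apply: le_lt_trans (norm1M _ _) _; apply: le_lt_trans h.
by rewrite mulrC ler_wpM2l ?norm1_ge0 // lerDl.
Qed.

Lemma cvg1M f g k l : cvg1 f k -> cvg1 g l -> cvg1 (fun i => f i * g i) (k * l).
Proof.
move=> fk gl e e0.
pose D := norm1 k + norm1 l + 2.
have D0 : 0 < D by rewrite /D; have := norm1_ge0 k; have := norm1_ge0 l; lra.
have e20 : 0 < e / D by rewrite divr_gt0.
apply: filterS2 (cvg1_bounded fk) (filterI (fk _ e20) (gl _ e20)) => i fi [h1 h2].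
have -> : f i * g i - k * l = f i * (g i - l) + (f i - k) * l by ring.
apply: le_lt_trans (norm1D _ _) _.
have h3 := norm1M (f i) (g i - l); have h4 := norm1M (f i - k) l.
have h5 : norm1 (f i) * norm1 (g i - l) <= (norm1 k + 1) * (e / D).
  by rewrite ler_pM ?norm1_ge0 // ltW.
have h6 : norm1 (f i - k) * norm1 l <= e / D * norm1 l.
  by rewrite ler_wpM2r ?norm1_ge0 // ltW.
have E : e = e / D * D by field; rewrite gt_eqF.
rewrite [X in _ < X]E {2}/D; lra.
Qed.

Lemma cvg1B f g k l : cvg1 f k -> cvg1 g l -> cvg1 (fun i => f i - g i) (k - l).
Proof.
move=> fk gl; have := cvg1D fk (cvg1Z (-1) gl).
by rewrite mulN1r; under eq_fun do rewrite mulN1r.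
Qed.


(** The limit of the derivatives is the derivative of the pointwise limit as
soon as the derivatives are equicontinuous at [x0], because the linear
approximation error is then small uniformly along the filter. *)
Lemma has_cderive_limit (x0 r : R) (f df : T -> R -> R[i]) (g : R -> R[i])
    (l : R[i]) :
  0 < r ->
  (\forall i \near F, forall t, `|t - x0| < r -> has_cderive (f i) t (df i t)) ->
  (forall t, `|t - x0| < r -> cvg1 (f ^~ t) (g t)) ->
  cvg1 (df ^~ x0) l ->
  (forall e, 0 < e -> exists2 d, 0 < d &
     \forall i \near F, forall t, `|t - x0| < d ->
       norm1 (df i t - df i x0) <= e) ->
  has_cderive g x0 l.
Proof.
move=> r0 fd fg dfl equi.
have approx e : 0 < e -> exists2 d, 0 < d & forall t, `|t - x0| < d ->
    norm1 (g t - g x0 - (t - x0)%:C * l) <= e * `|t - x0|.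
  move=> e0; have e20 : 0 < e / 2 by lra.
  have [d d0 dfe] := equi _ e20.
  exists (Num.min d r); first by rewrite lt_min d0.
  move=> t; rewrite lt_min => /andP[td tr].
  have cv : cvg1 (fun i => f i t - f i x0 - (t - x0)%:C * df i x0)
                 (g t - g x0 - (t - x0)%:C * l).
    apply: cvg1B; last exact: cvg1Z.
    by apply: cvg1B; apply: fg => //; rewrite subrr normr0.
  apply: norm1_le_lim cv _; apply: filterS2 fd dfe => i fdi dfi.
  have := @norm1_mean_value _ (fun s => f i s - s%:C * df i x0)
    (fun s => df i s - df i x0) t x0 (e / 2).
  have -> : f i t - t%:C * df i x0 - (f i x0 - x0%:C * df i x0) =
    f i t - f i x0 - (t - x0)%:C * df i x0 by rewrite rmorphB /=; ring.
  have -> : 2 * (e / 2) = e by field.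
  apply=> s sx.
  split; last by apply: dfi; exact: le_lt_trans sx td.
  apply: has_cderiveB; first by apply: fdi; exact: le_lt_trans sx tr.
  have := has_cderiveM (has_cderive_id s) (has_cderive_cst s (df i x0)).
  by rewrite mul1r mulr0 addr0.
have ReZ (r' : R) (u : R[i]) : complex.Re (r'%:C * u) = r' * complex.Re u.
  by case: u => ? ? /=; rewrite mul0r subr0.
have ImZ (r' : R) (u : R[i]) : complex.Im (r'%:C * u) = r' * complex.Im u.
  by case: u => ? ? /=; rewrite mul0r addr0.
apply/has_cderiveP; split; apply: linear_approx_is_derive => e /approx[d d0 gd];
  exists d => // t /gd; apply: le_trans; rewrite /norm1.
  by rewrite -ReZ -!raddfB lerDl.
by rewrite -ImZ -!raddfB lerDr.
Qed.

(** By [system_bounded] the solutions are bounded near [x0] uniformly in the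
parameter, hence so are their derivatives, which the system expresses
through the solutions. So the solutions are uniformly Lipschitz and, using
the system once more, their derivatives are equicontinuous at [x0]. *)
Lemma system_limit_component (U : set R) (m : R -> R[i]) (w : T -> R[i])
    (a b : T -> R -> R[i]) (w0 : R[i]) (a0 b0 : R -> R[i]) (x0 : R) :
  open U -> U x0 -> (forall x, U x -> cderivable m x) ->
  cvg1 w w0 ->
  (forall x, U x -> cvg1 (a ^~ x) (a0 x) /\ cvg1 (b ^~ x) (b0 x)) ->
  (\forall i \near F, forall x, U x ->
     has_cderive (a i) x (m x * a i x - w i * b i x) /\
     has_cderive (b i) x (- (m x * b i x) + w i * a i x)) ->
  has_cderive a0 x0 (m x0 * a0 x0 - w0 * b0 x0).
Proof.
move=> oU Ux0 dm ww0 ab0 dab.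
have cm : forall e, 0 < e -> \forall t \near x0, norm1 (m t - m x0) < e.
  move=> e e0; have e20 : 0 < e / 2 by lra.
  have [dr di] := dm _ Ux0.
  have c (f : R -> R) : derivable f x0 1 ->
      \forall t \near x0, `|f t - f x0| < e / 2.
    move=> /derivable1_diffP/differentiable_continuous/cvgrPdist_lt.
    by move=> /(_ _ e20); apply: filterS => t; rewrite distrC.
  apply: filterS2 (c _ di) (c _ dr) => t.
  rewrite /norm1 !raddfB /=; lra.
pose K := norm1 w0 + norm1 (m x0) + 1.
pose L := 2 * (norm1 (a0 x0) + norm1 (b0 x0) + 2).
have K0 : 0 < K by rewrite /K; have := norm1_ge0 w0; have := norm1_ge0 (m x0); lra.
have L0 : 0 < L.
  by rewrite /L; have := norm1_ge0 (a0 x0); have := norm1_ge0 (b0 x0); lra.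
have : \forall t \near x0, U t /\ norm1 (m t) <= K.
  apply: filterS2 (cm _ ltr01) (open_nbhs_nbhs (conj oU Ux0)) => t mt Ut.
  split => //; rewrite -[m t](subrK (m x0)) /K.
  have := norm1D (m t - m x0) (m x0); have := norm1_ge0 w0; lra.
move=> /nbhs_ballP[r /= r0 rP].
have {}rP t : `|t - x0| < r -> U t /\ norm1 (m t) <= K.
  by move=> tr; apply: rP; rewrite /ball /= distrC.
pose d := Num.min (r / 2) (8 * K)^-1.
have d0 : 0 < d by rewrite lt_min invr_gt0; apply/andP; split; lra.
have dr : d < r by rewrite gt_min; apply/orP; left; lra.
have Kd : 8 * K * d <= 1.
  rewrite -ler_pdivlMl; last lra.
  by rewrite mulr1 ge_min lexx orbT.
have dP t : `|t - x0| <= d -> U t /\ norm1 (m t) <= K.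
  by move=> td; apply: rP; exact: le_lt_trans td dr.
have [ca cb] := ab0 _ Ux0.
have near_bounds : \forall i \near F, [/\ norm1 (w i) <= K,
    forall t, `|t - x0| <= d -> has_cderive (a i) t (m t * a i t - w i * b i t)
      /\ has_cderive (b i) t (- (m t * b i t) + w i * a i t)
    & forall t, `|t - x0| <= d -> norm1 (a i t) + norm1 (b i t) <= L].
  apply: filterS2 (filterI (cvg1_bounded ca) (cvg1_bounded cb))
    (filterI (cvg1_bounded ww0) dab) => i [ai bi] [wi di].
  have wK : norm1 (w i) <= K.
    by rewrite /K; have := norm1_ge0 (m x0); lra.
  have dd t : `|t - x0| <= d -> has_cderive (a i) t (m t * a i t - w i * b i t)
      /\ has_cderive (b i) t (- (m t * b i t) + w i * a i t).
    by move=> /dP[Ut _]; exact: di.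
  split=> // t td.
  have := @system_bounded _ x0 d K m (w i) (a i) (b i) (ltW d0) (ltW K0) Kd.
  have h1 s : `|s - x0| <= d -> norm1 (m s) <= K by move=> /dP[].
  have h2 s : `|s - x0| <= d -> has_cderive (a i) s (m s * a i s - w i * b i s).
    by move=> /dd[].
  have h3 s : `|s - x0| <= d -> has_cderive (b i) s (- (m s * b i s) + w i * a i s).
    by move=> /dd[].
  move=> /(_ h1 wK h2 h3 t td); rewrite /L; lra.
have KL : 0 < K * L by rewrite mulr_gt0.
apply: (@has_cderive_limit x0 d a (fun i t => m t * a i t - w i * b i t)) => //.
- by apply: filterS near_bounds => i [_ H _] t /ltW/H[].
- by move=> t /ltW/dP[/ab0[]].
- apply: cvg1B; first exact: cvg1Z.
  exact: cvg1M.
move=> e e0.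
(* The increment of the derivative splits into three terms, of size at most
   [2 K^2 L |t - x0|], [L |m t - m x0|] and [2 K^2 L |t - x0|]. *)
pose e' := e / (L + 4 * K * (K * L) + 1).
have De : 0 < L + 4 * K * (K * L) + 1.
  by have := mulr_gt0 K0 KL; lra.
have e'0 : 0 < e' by rewrite divr_gt0.
have : \forall t \near x0, norm1 (m t - m x0) < e' by exact: cm.
move=> /nbhs_ballP[s /= s0 sP].
exists (Num.min (Num.min s e') d); first by rewrite lt_min d0 lt_min s0 e'0.
apply: filterS near_bounds => i [wK dd abL] t; rewrite lt_min.
move=> /andP[]; rewrite lt_min => /andP[ts te] /ltW td.
have mt : norm1 (m t - m x0) < e' by apply: sP; rewrite /ball /= distrC.
have nL u : `|u - x0| <= d -> norm1 (a i u) <= L /\ norm1 (b i u) <= L.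
  move=> /abL; have := norm1_ge0 (a i u); have := norm1_ge0 (b i u).
  by split; lra.
have prod_le (p q : R[i]) P Q : norm1 p <= P -> norm1 q <= Q ->
    norm1 (p * q) <= P * Q.
  move=> pP qQ; apply: le_trans (norm1M _ _) _.
  by rewrite ler_pM ?norm1_ge0.
have lip (f df : R -> R[i]) :
    (forall u, `|u - x0| <= d -> has_cderive f u (df u)) ->
    (forall u, `|u - x0| <= d -> norm1 (df u) <= K * L) ->
    norm1 (f t - f x0) <= 2 * (K * L) * e'.
  move=> fd fb; apply: le_trans (_ : _ <= 2 * (K * L) * `|t - x0|) _; last first.
    by rewrite ler_wpM2l //; lra.
  apply: (@norm1_mean_value _ f df) => u ut.
  have ud : `|u - x0| <= d by exact: le_trans ut td.
  by split; [exact: fd|exact: fb].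
have two_prod (p q f g : R[i]) : norm1 p <= K -> norm1 q <= K ->
    norm1 f + norm1 g <= L -> norm1 (p * f + q * g) <= K * L.
  move=> pK qK fgL; apply: le_trans (norm1D _ _) _.
  have h1 := prod_le _ _ _ _ pK (lexx (norm1 f)).
  have h2 := prod_le _ _ _ _ qK (lexx (norm1 g)).
  have : K * (norm1 f + norm1 g) <= K * L by rewrite ler_wpM2l // ltW.
  lra.
have la : norm1 (a i t - a i x0) <= 2 * (K * L) * e'.
  apply: (lip (a i) (fun u => m u * a i u - w i * b i u)) => u ud.
    by case: (dd _ ud).
  rewrite -mulNr; apply: two_prod; rewrite ?norm1N //; last exact: abL.
  by case: (dP _ ud).
have lb : norm1 (b i t - b i x0) <= 2 * (K * L) * e'.
  apply: (lip (b i) (fun u => - (m u * b i u) + w i * a i u)) => u ud.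
    by case: (dd _ ud).
  rewrite -mulNr; apply: two_prod; rewrite ?norm1N //.
    by case: (dP _ ud).
  by rewrite addrC; exact: abL.
have [_ mK] := dP _ td.
have x0d : `|x0 - x0| <= d by rewrite subrr normr0 ltW.
have -> : m t * a i t - w i * b i t - (m x0 * a i x0 - w i * b i x0) =
  m t * (a i t - a i x0) + (m t - m x0) * a i x0 - w i * (b i t - b i x0) by ring.
have [aL _] := nL _ x0d.
have h1 := prod_le _ _ _ _ mK la.
have h2 := prod_le _ _ _ _ (ltW mt) aL.
have h3 := prod_le _ _ _ _ wK lb.
have h4 := norm1B (m t * (a i t - a i x0) + (m t - m x0) * a i x0)
                  (w i * (b i t - b i x0)).
have h5 := norm1D (m t * (a i t - a i x0)) ((m t - m x0) * a i x0).
have E : e = e' * (L + 4 * K * (K * L) + 1) by rewrite /e'; field; rewrite gt_eqF.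
rewrite E; lra.
Qed.

(** The second component is the first one of the system in which the two
unknowns are exchanged and [m], [w] change sign. *)
Lemma system_limit (U : set R) (m : R -> R[i]) (w : T -> R[i])
    (a b : T -> R -> R[i]) (w0 : R[i]) (a0 b0 : R -> R[i]) :
  open U -> (forall x, U x -> cderivable m x) ->
  cvg1 w w0 ->
  (forall x, U x -> cvg1 (a ^~ x) (a0 x) /\ cvg1 (b ^~ x) (b0 x)) ->
  (\forall i \near F, forall x, U x ->
     has_cderive (a i) x (m x * a i x - w i * b i x) /\
     has_cderive (b i) x (- (m x * b i x) + w i * a i x)) ->
  forall x, U x ->
    has_cderive a0 x (m x * a0 x - w0 * b0 x) /\
    has_cderive b0 x (- (m x * b0 x) + w0 * a0 x).
Proof.
move=> oU dm ww0 ab0 dab x Ux; split.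
  exact: (system_limit_component oU Ux dm ww0 ab0 dab).
have := @system_limit_component U (fun t => - m t) (fun i => - w i) b a (- w0)
  b0 a0 x oU Ux.
rewrite !mulNr opprK; apply.
- by move=> t /dm/cderivable_has/has_cderiveN[].
- by have := cvg1Z (-1) ww0; rewrite mulN1r; under eq_fun do rewrite mulN1r.
- by move=> t /ab0[].
- by apply: filterS dab => i H t /H[]; rewrite !mulNr !opprK.
Qed.

End Limits.

(** * Alternating determinants *)

Definition alt_term (R : realType) (E F : R[i] -> R[i]) (k : nat) (w : R[i]) :
    R[i] := w ^+ k * (if odd k then F w else E w).

Definition nodes (R : realType) (z : nat -> R[i]) (n : nat) : 'I_n -> R[i] :=
  fun j => z j.
Arguments nodes {R} z n _.

Definition nodes_and (R : realType) (z : nat -> R[i]) (n : nat) (w : R[i]) :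
    'I_n.+1 -> R[i] :=
  fun j => if (j < n)%N then z j else w.
Arguments nodes_and {R} z n w _.

Section AlternatingDeterminants.
Variable R : realType.
Implicit Types (E F : R[i] -> R[i]) (z : nat -> R[i]) (w : R[i]).

Lemma nodes_andS z n : nodes_and z n (z n) =1 nodes z n.+1.
Proof.
move=> j; rewrite /nodes_and /nodes; case: ltnP => // nj.
by congr z; apply/eqP; rewrite eqn_leq nj -ltnS ltn_ord.
Qed.

Lemma eq_altdet E F m (zeta zeta' : 'I_m -> R[i]) :
  zeta =1 zeta' -> altdet E F zeta = altdet E F zeta'.
Proof. by move=> eqz; congr (\det _); apply/matrixP => k j; rewrite !mxE eqz. Qed.

(** Expansion along the last column, the only one containing [w]. *)
Lemma altdet_expand E F z n : exists c : nat -> R[i], forall w,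
  altdet E F (nodes_and z n w) =
  altdet E F (nodes z n) * alt_term E F n w
  + \sum_(k < n) c k * alt_term E F k w.
Proof.
exists (fun k => (-1) ^+ (k + n) *
  \det (\matrix_(i < n, j < n) alt_term E F (bump k i) (z j))) => w.
rewrite /altdet (expand_det_col _ ord_max) big_ord_recr /= addrC; congr (_ + _).
  rewrite !mxE /nodes_and /= ltnn mulrC; congr (_ * _).
  rewrite /cofactor /= addnn -signr_odd odd_double expr0 mul1r; congr (\det _).
  apply/matrixP => i j; rewrite !mxE /nodes /= /bump.
  by rewrite [(n <= i)%N]leqNgt [(n <= j)%N]leqNgt !ltn_ord /= !add0n ?ltn_ord.
apply: eq_bigr => k _; rewrite !mxE /nodes_and /= ltnn mulrC; congr (_ * _).
rewrite /cofactor /=; congr (_ * \det _).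
apply/matrixP => i j; rewrite !mxE /alt_term /=.
by rewrite [bump n j]/bump [(n <= j)%N]leqNgt ltn_ord /= add0n ?ltn_ord.
Qed.

Lemma altdet_repeated E F z n j : (j < n)%N ->
  altdet E F (nodes_and z n (z j)) = 0.
Proof.
move=> jn; rewrite /altdet -det_tr.
apply: (@determinant_alternate _ _ _ (widen_ord (leqnSn n) (Ordinal jn)) ord_max).
  by rewrite neq_ltn /= jn.
by move=> k; rewrite !mxE /nodes_and /= jn ltnn.
Qed.

Lemma alt_terms_free E F z n (c : nat -> R[i]) :
  altdet E F (nodes z n) <> 0 ->
  (forall j, (j < n)%N -> \sum_(k < n) c k * alt_term E F k (z j) = 0) ->
  forall k, (k < n)%N -> c k = 0.
Proof.
move=> d0 cz k kn.
pose M : 'M[R[i]]_n := \matrix_(k, j) alt_term E F k (z j).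
have uM : M \in unitmx by rewrite unitmxE unitfE; apply/eqP.
have vM : (\row_(k < n) c k) *m M = 0.
  apply/rowP => j; rewrite !mxE -[RHS](cz j) //.
  by apply: eq_bigr => i _; rewrite !mxE.
have v0 : \row_(k < n) c k = 0 by rewrite -[LHS](mulmxK uM) vM mul0mx.
by have /rowP/(_ (Ordinal kn)) := v0; rewrite !mxE.
Qed.

(** A monic combination of the functions [alt_term] that vanishes at the nodes
is unique, since by [alt_terms_free] the difference of two of them is zero;
the expansion of the bordered determinant is one, up to its leading
coefficient. *)
Lemma altdet_monic E F z n (c : nat -> R[i]) (g : R[i] -> R[i]) :
  altdet E F (nodes z n) <> 0 ->
  (forall w, g w = alt_term E F n w + \sum_(k < n) c k * alt_term E F k w) ->
  (forall j, (j < n)%N -> g (z j) = 0) ->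
  forall w, altdet E F (nodes_and z n w) = altdet E F (nodes z n) * g w.
Proof.
move=> d0 gE gz w; have [b bE] := altdet_expand E F z n.
set d := altdet E F (nodes z n) in d0 bE *.
have diffE v : altdet E F (nodes_and z n v) - d * g v =
    \sum_(k < n) (b k - d * c k) * alt_term E F k v.
  rewrite bE gE mulrDr mulr_sumr [X in X - _]addrC addrKA -sumrB.
  by apply: eq_bigr => k _; rewrite mulrBl mulrA.
have bc k : (k < n)%N -> b k - d * c k = 0.
  apply: (@alt_terms_free E F z n (fun k => b k - d * c k)) => // j jn.
  by rewrite -diffE altdet_repeated // gz // mulr0 subr0.
apply/eqP; rewrite -subr_eq0 diffE big1 // => k _.
by rewrite bc // mul0r.
Qed.

(** The monic combination of [alt_term E F k], for [k] up to [n], that vanishes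
at the first [n] nodes. *)
Definition altpoly E F z n w :=
  altdet E F (nodes_and z n w) / altdet E F (nodes z n).

Lemma altpoly_root E F z n j : (j < n)%N -> altpoly E F z n (z j) = 0.
Proof. by move=> jn; rewrite /altpoly altdet_repeated // mul0r. Qed.

Lemma altpoly_expand E F z n : altdet E F (nodes z n) <> 0 ->
  exists c : nat -> R[i], forall w, altpoly E F z n w =
    alt_term E F n w + \sum_(k < n) c k * alt_term E F k w.
Proof.
move=> /eqP d0; have [c cE] := altdet_expand E F z n.
exists (fun k => c k / altdet E F (nodes z n)) => w.
rewrite /altpoly cE mulrDl mulrC mulKf // mulr_suml; congr (_ + _).
by apply: eq_bigr => k _; rewrite mulrAC.
Qed.

Lemma altdet_nodesS E F z n : altdet E F (nodes z n) <> 0 ->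
  altdet E F (nodes z n.+1) = altdet E F (nodes z n) * altpoly E F z n (z n).
Proof.
move=> /eqP d0; rewrite /altpoly (eq_altdet _ _ (@nodes_andS z n)).
by rewrite mulrC divfK.
Qed.

Lemma mul_alt_term E F k w : w * alt_term F E k w = alt_term E F k.+1 w.
Proof. by rewrite /alt_term exprS mulrA /=; case: odd. Qed.

(** Multiplication by [w] turns the terms of the exchanged pair [(F, E)] into
those of [(E, F)], one degree higher. The right-hand side is therefore
monic of degree [n.+1]; it vanishes at the old nodes because both summands
do, and at [z n] by the choice of the coefficient. Conclude by
[altdet_monic]. *)
Lemma altpolyS E F z n w :
  altdet E F (nodes z n) <> 0 -> altdet F E (nodes z n) <> 0 ->
  altdet E F (nodes z n.+1) <> 0 ->
  altpoly E F z n.+1 w =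
  w * altpoly F E z n w
  - z n * altpoly F E z n (z n) / altpoly E F z n (z n) * altpoly E F z n w.
Proof.
move=> d0 d0' d1.
have p0 : altpoly E F z n (z n) != 0.
  by apply/eqP => p0; apply: d1; rewrite altdet_nodesS // p0 mulr0.
have [c cE] := altpoly_expand d0; have [b bE] := altpoly_expand d0'.
set l := _ / altpoly E F z n (z n).
pose a k := (if k is k'.+1 then b k' else 0) - l * (if k == n then 1 else c k).
rewrite {1}/altpoly (@altdet_monic E F z n.+1 a
  (fun w => w * altpoly F E z n w - l * altpoly E F z n w)) //.
- by rewrite mulrAC divff ?mul1r //; apply/eqP.
- move=> v; rewrite bE cE mulrDr mul_alt_term -addrA; congr (_ + _).
  under [X in _ = X]eq_bigr do rewrite mulrBl.
  rewrite sumrB; congr (_ - _).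
    rewrite big_ord_recl mul0r add0r mulr_sumr; apply: eq_bigr => k _.
    by rewrite mulrCA mul_alt_term.
  rewrite big_ord_recr /= eqxx mulr1 addrC mulrDr mulr_sumr; congr (_ + _).
  by apply: eq_bigr => k _; rewrite ltn_eqF // mulrA.
move=> j; rewrite ltnS leq_eqVlt => /predU1P[->|jn].
  by rewrite /l divfK // subrr.
by rewrite !altpoly_root // !mulr0 subrr.
Qed.

End AlternatingDeterminants.

(** * Punctured limits in the complex plane *)
Section ComplexLimits.
Variable R : realType.
Implicit Types (u v w l : R[i]) (f g : R[i] -> R[i]).

Lemma normc_le_norm1 u : `|u| <= (norm1 u)%:C.
Proof.
rewrite /norm1 rmorphD /= {1}[u]complexE; apply: le_trans (ler_normD _ _) _.
rewrite normrM !normc_def /= !expr0n /= !addr0 !add0r !expr1n !sqrtr1 mul1r.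
by rewrite !sqrtr_sqr.
Qed.

Lemma cvg1_iff (T : Type) (F : set_system T) (FF : Filter F) (f : T -> R[i]) l :
  (f : T -> R[i]^o) @ F --> (l : R[i]^o) <-> @cvg1 R T F f l.
Proof.
split=> [/cvgrPdist_lt fl e e0|fl].
  have e20 : (0 : R[i]) < (e / 2)%:C by rewrite ltcR; lra.
  apply: filterS (fl _ e20) => i h.
  have := norm1_le_normc (f i - l); rewrite distrC.
  move=> /le_lt_trans H; have {H} := H (2 * (e / 2)%:C).
  rewrite ltr_pM2l // => /(_ h).
  have -> : 2 * (e / 2)%:C = e%:C.
    by rewrite -[2](rmorph_nat (real_complex R)) -rmorphM /=; congr _%:C; field.
  by rewrite ltcR.
apply/cvgrPdist_lt => e e0.
have [r Er] : exists r, e = r%:C by apply/complex_realP; rewrite gtr0_real.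
rewrite Er ltcR in e0 *; apply: filterS (fl _ e0) => i h.
rewrite distrC; apply: le_lt_trans (normc_le_norm1 _) _.
by rewrite ltcR.
Qed.

(** The convergence that defines [extend]. *)
Definition pcvg f w l := @cvg1 R R[i] (dnbhs (w : R[i]^o)) f l.

Lemma pcvg_unique f w l l' : pcvg f w l -> pcvg f w l' -> l = l'.
Proof.
move=> /cvg1_iff fl /cvg1_iff fl'.
exact: (@cvg_unique _ (@norm_hausdorff _ R[i]^o) _ _ _ _ fl fl').
Qed.

Lemma pcvg_extend f w l : pcvg f w l -> extend f w = l.
Proof. by move=> /cvg1_iff fl; exact: (cvg_lim (@norm_hausdorff _ R[i]^o) fl). Qed.

Lemma pcvg_near f g w l : (\forall v \near dnbhs (w : R[i]^o), f v = g v) ->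
  pcvg f w l -> pcvg g w l.
Proof. by move=> fg fl e /fl; apply: filterS2 fg => v ->. Qed.

Lemma near_neq w c : w <> c -> \forall v \near dnbhs (w : R[i]^o), v <> c.
Proof.
move=> wc; apply: nbhs_dnbhs; apply/nbhs_ballP; exists `|w - c|.
  by rewrite /= normr_gt0 subr_eq0; apply/eqP.
by move=> v + vc; rewrite /ball /= vc ltxx.
Qed.

Lemma near_dnbhs_neq w : \forall v \near dnbhs (w : R[i]^o), v <> w.
Proof. by apply: filterS (nbhs_dnbhs_neq (w : R[i]^o)) => v /eqP. Qed.

Lemma pcvg_id w : pcvg id w w.
Proof. by apply/cvg1_iff; exact: cvg_within. Qed.

Lemma pcvgV f w l : l <> 0 -> pcvg f w l -> pcvg (fun v => (f v)^-1) w l^-1.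
Proof.
by move=> /eqP l0 /cvg1_iff fl; apply/cvg1_iff; exact: (@cvgV R[i] _ _ _ f l l0 fl).
Qed.

Lemma pcvg_cst c w : pcvg (fun=> c) w c.
Proof. exact: cvg1_cst. Qed.

Lemma pcvgD f g w k l : pcvg f w k -> pcvg g w l ->
  pcvg (fun v => f v + g v) w (k + l).
Proof. by move=> fk gl; exact: (cvg1D fk gl). Qed.

Lemma pcvgB f g w k l : pcvg f w k -> pcvg g w l ->
  pcvg (fun v => f v - g v) w (k - l).
Proof. by move=> fk gl; exact: (cvg1B fk gl). Qed.

Lemma pcvgM f g w k l : pcvg f w k -> pcvg g w l ->
  pcvg (fun v => f v * g v) w (k * l).
Proof. by move=> fk gl; exact: (cvg1M fk gl). Qed.

Lemma pcvg_prod (I : Type) (s : seq I) (f : I -> R[i] -> R[i]) (l : I -> R[i]) w :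
  (forall i, pcvg (f i) w (l i)) ->
  pcvg (fun v => \prod_(i <- s) f i v) w (\prod_(i <- s) l i).
Proof.
move=> fl; elim: s => [|i s IH].
  by under eq_fun do rewrite big_nil; rewrite big_nil; exact: pcvg_cst.
by under eq_fun do rewrite big_cons; rewrite big_cons; apply: pcvgM.
Qed.

Lemma entire_continuous f w : entire f -> pcvg f w (f w).
Proof.
move=> /(_ w)/derivable1_diffP/differentiable_continuous/continuous_withinNx fw.
by apply/cvg1_iff.
Qed.

Lemma entire_difference_quotient f w : entire f ->
  exists l, pcvg (fun v => (f v - f w) / (v - w)) w l.
Proof.
move=> /(_ w)/cvg_ex[/= l /cvg1_iff fl]; exists l => e /fl.
move=> /nbhs_ballP[r /= r0 rP]; apply/nbhs_ballP; exists r => //= v vw vnw.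
have := rP (v - w).
rewrite /ball /= sub0r normrN -(distrC w) => /(_ vw).
rewrite subr_eq0 => /(_ vnw).
by rewrite /GRing.scale /= mulr1 subrK mulrC.
Qed.

End ComplexLimits.

(** * The alternating determinants do not vanish *)
Section Independence.
Variables (R : realType) (H : hilbert_entire R) (A B : R[i] -> R[i])
  (Z : R[i] -> R[i] -> R[i]) (z : nat -> R[i]).
Hypotheses (A_entire : entire A) (B_entire : entire B)
  (A_even : forall w, A (- w) = A w) (B_odd : forall w, B (- w) = - B w)
  (Z_evaluator : forall v, is_evaluator H v (Z v))
  (Z_formula : forall v w, w <> v^* ->
     Z v w = 2 * (((B v)^* * A w - (A v)^* * B w) / (v^* - w)))
  (z_imaginary : forall i, complex.Re (z i) = 0)
  (z_distinct : forall i j, i <> j -> z i <> z j)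
  (z_not_opp : forall i j, z i <> - z j)
  (z_indep : lin_indep (fun i => Z (z i))).

Lemma conj_imaginary i : (z i)^* = - z i.
Proof.
have := z_imaginary i; case: (z i) => a b /= ->.
by rewrite /= /GRing.opp /= oppr0.
Qed.

(** The kernel formula has a denominator vanishing at [v^*] while [Z v] is
continuous there. At an imaginary node this replaces the symmetry of [A]
and [B] under conjugation. *)
Lemma kernel_numerator_diag v : (B v)^* * A v^* - (A v)^* * B v^* = 0.
Proof.
pose h w := (B v)^* * A w - (A v)^* * B w.
have cA := entire_continuous v^* A_entire.
have cB := entire_continuous v^* B_entire.
have cZ := entire_continuous v^* (he_entire (Z_evaluator v).1).
have ch : pcvg h v^* (h v^*).
  by apply: pcvgB; apply: pcvgM; rewrite ?/pcvg //; exact: pcvg_cst.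
have c0 : pcvg (fun w => Z v w * ((v^* - w) * 2^-1)) v^*
    (Z v v^* * ((v^* - v^*) * 2^-1)).
  apply: pcvgM; first exact: cZ.
  apply: pcvgM; last exact: pcvg_cst.
  by apply: pcvgB; [exact: pcvg_cst|exact: pcvg_id].
rewrite -[LHS]/(h v^*); apply: (pcvg_unique ch).
rewrite subrr mul0r mulr0 in c0; apply: pcvg_near c0.
apply: filterS (near_dnbhs_neq v^*) => w wv.
rewrite (Z_formula wv) -/(h w); field.
by rewrite subr_eq0; apply/eqP => /esym.
Qed.

Lemma evaluator_combination (n : nat) (c : 'I_n -> R[i]) :
  let f := fun w => \sum_(i < n) c i * Z (z i) w in
  he_mem H f /\ forall g, he_mem H g ->
    he_ip H g f = \sum_(i < n) c i * (g (z i))^*.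
Proof.
elim: n c => [|n IH] c /=.
  have -> : (fun w => \sum_(i < 0) c i * Z (z i) w) = fun=> 0.
    by apply/funext => w; rewrite big_ord0.
  split=> [|g gH]; first exact: he_mem0.
  have := he_ip_linear (-1) gH (he_mem0 H) (he_mem0 H).
  have -> : (fun w : R[i] => -1 * 0 + 0) = fun=> (0 : R[i]).
    by apply/funext => w; rewrite mulr0 addr0.
  by move=> ->; rewrite mulN1r addNr big_ord0.
have [mf ipf] := IH (fun i => c (widen_ord (leqnSn n) i)).
have [mZ evZ] := Z_evaluator (z n).
have -> : (fun w => \sum_(i < n.+1) c i * Z (z i) w) =
  fun w => c ord_max * Z (z n) w +
    \sum_(i < n) c (widen_ord (leqnSn n) i) * Z (z i) w.
  by apply/funext => w; rewrite big_ord_recr /= addrC.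
split=> [|g gH]; first exact: (he_memP (c ord_max) mZ mf).
rewrite (he_ip_linear (c ord_max) gH mZ mf) ipf // big_ord_recr /= addrC.
by rewrite (he_ip_conj mZ gH) -evZ.
Qed.

(** Evaluating at the nodes is taking scalar products with the [Z (z j)], so
the combination is orthogonal to itself. *)
Lemma evaluator_combination_eq0 (n : nat) (c : 'I_n -> R[i]) :
  (forall j : 'I_n, \sum_(i < n) c i * Z (z i) (z j) = 0) -> forall i, c i = 0.
Proof.
move=> fz; have [mf ipf] := evaluator_combination c.
apply: z_indep => w.
have /(congr1 (fun f => f w)) // : (fun w => \sum_(i < n) c i * Z (z i) w) = fun=> 0.
apply: (he_ip_eq0 mf); rewrite ipf //.
by apply: big1 => i _; rewrite fz conjC0 mulr0.
Qed.

(** Otherwise [Z (z j)] would have norm zero. *)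
Lemma AB_not_both0 j : A (z j) = 0 -> B (z j) = 0 -> False.
Proof.
move=> Aj Bj; have [mZ evZ] := Z_evaluator (z j).
have Z0 : Z (z j) = fun=> 0.
  apply: (he_ip_eq0 mZ); rewrite -evZ // Z_formula.
    by rewrite Aj Bj !mulr0 subrr mul0r mulr0.
  by rewrite conj_imaginary; exact: z_not_opp.
have := @z_indep j.+1 (fun i => (i == j :> nat)%:R) _ ord_max.
rewrite /= eqxx => /(_ _)/eqP; rewrite oner_eq0 => absurd.
apply: notF; apply: absurd.
move=> w; apply: big1 => i _; have [->|_] := eqVneq (i : nat) j; last first.
  by rewrite mul0r.
by rewrite Z0 mulr0.
Qed.


(** In the plane, [(p, q)] and the pair of the conjugates of [B (z j)] and
[- A (z j)] are both annihilated by the nonzero form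
[(A (z j), - B (z j))]: the latter by [kernel_numerator_diag] and parity. *)
Lemma evaluator_direction j (p q : R[i]) :
  p * A (z j) - q * B (z j) = 0 ->
  exists l, p = l * (B (z j))^* /\ q = - (l * (A (z j))^*).
Proof.
move=> pq; have := kernel_numerator_diag (z j).
rewrite conj_imaginary A_even B_odd => num0.
have [A0|A0] := eqVneq (A (z j)) 0.
  have B0 : B (z j) != 0 by apply/eqP => /(AB_not_both0 A0).
  have cB0 : (B (z j))^* != 0 by rewrite conjC_eq0.
  exists (p / (B (z j))^*); split; first by rewrite divfK.
  move: pq; rewrite A0 mulr0 sub0r conjC0 mulr0 oppr0 => /eqP.
  by rewrite oppr_eq0 mulf_eq0 (negPf B0) orbF => /eqP.
have cA0 : (A (z j))^* != 0 by rewrite conjC_eq0.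
exists (- (q / (A (z j))^*)); split; last by rewrite mulNr opprK divfK.
apply: (mulIf A0); apply: (mulIf cA0).
have -> : - (q / (A (z j))^*) * (B (z j))^* * A (z j) * (A (z j))^* =
  - q * ((B (z j))^* * A (z j)) by field.
have -> : (B (z j))^* * A (z j) = - ((A (z j))^* * B (z j)).
  by move/eqP: num0; rewrite mulrN opprK addr_eq0 => /eqP.
have -> : p * A (z j) = q * B (z j) by apply/eqP; rewrite -subr_eq0 pq.
ring.
Qed.

(** Dividing [P A + Q B] by the product of the [w + z j] gives a combination
of the evaluators [Z (z j)]: in partial fractions the coefficients at
[w = - z j] are proportional to those of the kernel formula, by the
vanishing at [- z j] and [evaluator_direction]. The vanishing at the [z j]
then forces this combination to be zero, and [P], [Q] vanish at [n] points
each. *)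
Lemma polynomial_combination_eq0 n (P Q : {poly R[i]}) :
  (size P <= n)%N -> (size Q <= n)%N ->
  (forall j, (j < n)%N -> P.[z j] * A (z j) + Q.[z j] * B (z j) = 0) ->
  (forall j, (j < n)%N -> P.[- z j] * A (z j) - Q.[- z j] * B (z j) = 0) ->
  P = 0 /\ Q = 0.
Proof.
case: n => [|n]; first by rewrite !leqn0 !size_poly_eq0 => /eqP -> /eqP ->.
move=> sP sQ Hp Hm.
pose y j := - z j.
have y_inj : injective y.
  move=> i j /oppr_inj zij; apply/eqP/negPn/negP => /eqP ij.
  exact: (z_distinct ij zij).
have /choice[lam lamP] : forall j : 'I_n.+1, exists l : R[i],
    P.[y j] = l * (B (z j))^* /\ Q.[y j] = - (l * (A (z j))^*).
  by move=> j; apply: evaluator_direction; exact: Hm.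
(* Lagrange interpolation at the nodes [y j] is the partial fraction
   expansion multiplied by [omega]. *)
pose k (j : 'I_n.+1) := (\prod_(i < n.+1 | i != j) ('X - (y i)%:P)).[y j]^-1.
have k0 j : k j != 0.
  rewrite invr_eq0 horner_prod; apply/prodf_neq0 => i ij.
  by rewrite hornerXsubC subr_eq0 inj_eq // eq_sym.
pose omega w := \prod_(i < n.+1) (w - y i).
have interp (p : {poly R[i]}) (i : 'I_n.+1) : (size p <= n.+1)%N ->
    p.[z i] = \sum_(j < n.+1) p.[y j] * (k j * omega (z i) / (z i - y j)).
  move=> sp; rewrite {1}(lagrange_gen (ltn0Sn n) y_inj sp) horner_sum.
  apply: eq_bigr => j _; rewrite hornerM hornerC lagrangeE //=.
  rewrite hornerM hornerC -/(k j) horner_prod /omega [in RHS](bigD1 j) //=.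
  under eq_bigr do rewrite hornerXsubC.
  congr (_ * _); rewrite -mulrA; congr (_ * _); rewrite mulrAC divff ?mul1r //.
  by rewrite subr_eq0; apply/eqP; exact: z_not_opp.
have lam0 j : k j * lam j = 0.
  apply: (@evaluator_combination_eq0 n.+1 (fun j => k j * lam j)) => i.
  have w0 : omega (z i) != 0.
    by apply/prodf_neq0 => l _; rewrite subr_eq0; apply/eqP; exact: z_not_opp.
  have /eqP := Hp i (ltn_ord i).
  rewrite (interp P) // (interp Q) // !mulr_suml -big_split /=.
  rewrite (eq_bigr (fun j => - (omega (z i) / 2) * (k j * lam j * Z (z j) (z i)))).
    rewrite -mulr_sumr mulf_eq0 => /orP[|/eqP //].
    by rewrite oppr_eq0 mulf_eq0 (negPf w0) invr_eq0 pnatr_eq0.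
  move=> l _; have [-> ->] := lamP l.
  rewrite Z_formula conj_imaginary; last exact: z_not_opp.
  have h1 : z i + z l != 0 by rewrite addr_eq0; apply/eqP; exact: z_not_opp.
  rewrite /y; field.
  by rewrite opprK h1 -opprD addrC oppr_eq0 h1.
have PQ0 (j : 'I_n.+1) : P.[y j] = 0 /\ Q.[y j] = 0.
  have := lam0 j; move=> /eqP; rewrite mulf_eq0 (negPf (k0 j)) /= => /eqP l0.
  by have [-> ->] := lamP j; rewrite l0 !mul0r oppr0.
split.
  rewrite (lagrange_gen (ltn0Sn n) y_inj sP) big1 // => j _.
  by have [-> _] := PQ0 j; rewrite mul0r.
rewrite (lagrange_gen (ltn0Sn n) y_inj sQ) big1 // => j _.
by have [_ ->] := PQ0 j; rewrite mul0r.
Qed.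

(** A linear relation between the rows of [altdet], read as an even
polynomial times [E] plus an odd one times [F]. *)
Lemma altdet_eq0_polynomials (E F : R[i] -> R[i]) n :
  altdet E F (nodes z n) = 0 ->
  exists P Q : {poly R[i]},
    [/\ (size P <= n)%N, (size Q <= n)%N,
       forall w, P.[- w] = P.[w] /\ Q.[- w] = - Q.[w],
       forall j, (j < n)%N -> P.[z j] * E (z j) + Q.[z j] * F (z j) = 0
     & ~ (P = 0 /\ Q = 0)].
Proof.
move=> /eqP/det0P[v v0 vM].
pose c k := (rVpoly v)`_k.
exists (\poly_(k < n) (if odd k then 0 else c k)).
exists (\poly_(k < n) (if odd k then c k else 0)).
split; rewrite ?size_poly //.
- move=> w; rewrite !horner_poly -sumrN; split; apply: eq_bigr => k _;
    rewrite exprNn -signr_odd; case: odd; rewrite ?expr0 ?expr1; ring.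
- move=> j jn; have /rowP/(_ (Ordinal jn)) := vM; rewrite !mxE => vMj.
  rewrite -[RHS]vMj.
  rewrite !horner_poly !mulr_suml -big_split; apply: eq_bigr => k _ /=.
  rewrite !mxE /nodes /= -(coef_rVpoly_ord v k) /c; case: odd => /=; ring.
move=> [P0 Q0]; move: v0 => /eqP; apply; apply/rowP => k.
rewrite mxE -coef_rVpoly_ord -/(c k).
have /polyP/(_ (k : nat)) := P0; have /polyP/(_ (k : nat)) := Q0.
by rewrite !coef_poly !coef0 ltn_ord; case: odd.
Qed.

(** The relation of [altdet_eq0_polynomials] gives a function of definite
parity, which vanishes at the [- z j] too. *)
Lemma altdet_AB_neq0 n : altdet A B (nodes z n) <> 0.
Proof.
move=> /altdet_eq0_polynomials[P [Q [sP sQ par PQ]]]; apply.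
apply: (polynomial_combination_eq0 sP sQ PQ) => j jn.
by have [-> ->] := par (z j); rewrite mulNr opprK PQ.
Qed.

Lemma altdet_BA_neq0 n : altdet B A (nodes z n) <> 0.
Proof.
move=> /altdet_eq0_polynomials[P [Q [sP sQ par PQ]]] nPQ.
have [j jn|j jn|Q0 P0] := @polynomial_combination_eq0 n Q P sQ sP.
- by rewrite addrC PQ.
- have [-> ->] := par (z j); apply/eqP; rewrite mulNr -opprD oppr_eq0.
  by rewrite addrC PQ.
by apply: nPQ.
Qed.

End Independence.

(** * Removable singularities of the modified functions *)
Section Entire.
Variable R : realType.
Implicit Types (f g : R[i] -> R[i]).

Lemma entire_cst (c : R[i]) : entire (fun=> c).
Proof. by move=> w; exact: derivable_cst. Qed.

Lemma entireD f g : entire f -> entire g -> entire (fun w => f w + g w).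
Proof. by move=> ef eg w; exact: (derivableD (ef w) (eg w)). Qed.

Lemma entireM f g : entire f -> entire g -> entire (fun w => f w * g w).
Proof. by move=> ef eg w; exact: (derivableM (ef w) (eg w)). Qed.

Lemma entireX k : entire (fun w : R[i] => w ^+ k).
Proof. by move=> w; exact: exprn_derivable. Qed.

Lemma entire_sum n (f : 'I_n -> R[i] -> R[i]) : (forall k, entire (f k)) ->
  entire (fun w => \sum_(k < n) f k w).
Proof.
elim: n f => [|n IH] f ef.
  by under eq_fun do rewrite big_ord0; exact: entire_cst.
by under eq_fun do rewrite big_ord_recr; apply: entireD; [exact: IH|exact: ef].
Qed.

End Entire.

Section Regularity.
Variables (R : realType) (z : nat -> R[i]).
Hypotheses (z_imaginary : forall i, complex.Re (z i) = 0)
  (z_distinct : forall i j, i <> j -> z i <> z j)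
  (z_not_opp : forall i j, z i <> - z j).

Definition node_product (n : nat) (w : R[i]) : R[i] :=
  \prod_(i < n) (w ^+ 2 - z i ^+ 2).

Lemma node_productS n w :
  node_product n.+1 w = node_product n w * (w ^+ 2 - z n ^+ 2).
Proof. by rewrite /node_product big_ord_recr. Qed.

Lemma node_sqr_inj i j : z i ^+ 2 = z j ^+ 2 -> i = j.
Proof.
move=> /eqP; rewrite eqf_sqr => /orP[] /eqP zij; last by case: (z_not_opp zij).
by apply/eqP/negPn/negP => /eqP ij; exact: (z_distinct ij zij).
Qed.

Lemma node_product_node n : node_product n (z n) != 0.
Proof.
apply/prodf_neq0 => i _; rewrite subr_eq0; apply/eqP => /node_sqr_inj ni.
by have := ltn_ord i; rewrite -ni ltnn.
Qed.

Lemma node_product_eq0 n w : node_product n w = 0 ->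
  exists i : 'I_n, w ^+ 2 = z i ^+ 2.
Proof.
move=> /eqP; rewrite /node_product prodf_seq_eq0 => /hasP[i _ /=].
by rewrite subr_eq0 => /eqP wi; exists i.
Qed.

Lemma node_neq0 i : z i != 0.
Proof.
by apply/eqP => zi; apply: (z_not_opp (i := i) (j := i)); rewrite zi oppr0.
Qed.

Lemma near_node_product n w :
  \forall v \near dnbhs (w : R[i]^o), node_product n v != 0.
Proof.
have near_neq' c : \forall v \near dnbhs (w : R[i]^o), v <> c.
  by have [<-|/eqP wc] := eqVneq w c; [exact: near_dnbhs_neq|exact: near_neq].
elim: n => [|n IH].
  by apply: nearW => v; rewrite /node_product big_ord0 oner_eq0.
apply: filterS2 (filterI (near_neq' (z n)) (near_neq' (- z n))) IH => v [v1 v2] v3.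
rewrite node_productS mulf_neq0 // subr_eq0 eqf_sqr negb_or.
by apply/andP; split; apply/eqP.
Qed.

(** As [z i] is imaginary, its conjugate is [- z i]. *)
Lemma gammaE n w : gamma z n w * gamma_star z n w = (node_product n w)^-1.
Proof.
rewrite /gamma_star /gamma rmorph_prod -big_split /node_product -prodfV.
apply: eq_bigr => i _ /=; rewrite fmorphV rmorphB /= conjCK conj_imaginary //.
by rewrite opprK -invfM subr_sqr.
Qed.

Lemma altdet_ratioE E F n w :
  altdet_ratio z n E F w = altpoly E F z n w / node_product n w.
Proof. by rewrite /altdet_ratio gammaE mulrC. Qed.

Section Functions.
Variables (E F : R[i] -> R[i]) (s : R[i]).
Hypotheses (E_entire : entire E) (F_entire : entire F)
  (E_parity : forall w, E (- w) = s * E w)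
  (F_parity : forall w, F (- w) = - s * F w)
  (d_neq0 : forall n, altdet E F (nodes z n) <> 0).

Lemma altpoly_entire n : entire (altpoly E F z n).
Proof.
have [c cE] := altpoly_expand (@d_neq0 n).
have te k : entire (alt_term E F k).
  have ek : entire (fun w => if odd k then F w else E w).
    by case: (odd k); [exact: F_entire|exact: E_entire].
  exact: (entireM (@entireX R k) ek).
have -> : altpoly E F z n = fun w =>
    alt_term E F n w + \sum_(k < n) c k * alt_term E F k w.
  by apply/funext.
apply: (entireD (te n)); apply: entire_sum => k.
exact: (entireM (@entire_cst R (c k)) (te k)).
Qed.

Lemma altpoly_parity n w : altpoly E F z n (- w) = s * altpoly E F z n w.
Proof.
have [c cE] := altpoly_expand (@d_neq0 n).
have tp k : alt_term E F k (- w) = s * alt_term E F k w.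
  rewrite /alt_term exprNn -signr_odd; case: odd.
    by rewrite F_parity expr1; ring.
  by rewrite E_parity expr0; ring.
rewrite !cE tp mulrDr mulr_sumr; congr (_ + _).
by apply: eq_bigr => k _; rewrite tp mulrCA.
Qed.

Lemma node_product_cvg n w : pcvg (node_product n) w (node_product n w).
Proof.
apply: pcvg_prod => i; apply: pcvgB; last exact: pcvg_cst.
by rewrite expr2; under eq_fun do rewrite expr2; apply: pcvgM; exact: pcvg_id.
Qed.

Lemma altdet_ratio_cvg n w : node_product n w != 0 ->
  pcvg (altdet_ratio z n E F) w (altdet_ratio z n E F w).
Proof.
move=> /eqP pw.
have -> : altdet_ratio z n E F = fun v => altpoly E F z n v / node_product n v.
  by apply/funext => v; rewrite altdet_ratioE.
apply: pcvgM; first exact: (entire_continuous w (@altpoly_entire n)).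
by apply: pcvgV => //; exact: node_product_cvg.
Qed.

(** The numerator is entire and, by its parity, vanishes at [- z i] as well as
at [z i]; since [z i] is nonzero and the squares of the nodes are distinct,
the zeros of the denominator are simple. *)
Lemma altdet_ratio_ex_cvg n w : exists l, pcvg (altdet_ratio z n E F) w l.
Proof.
have [/node_product_eq0[i wi]|pw] := eqVneq (node_product n w) 0; last first.
  by exists (altdet_ratio z n E F w); exact: altdet_ratio_cvg.
have w0 : w != 0 by rewrite -sqrf_eq0 wi sqrf_eq0 node_neq0.
have pw : altpoly E F z n w = 0.
  move: wi => /eqP; rewrite eqf_sqr => /orP[] /eqP ->.
    by rewrite altpoly_root.
  by rewrite altpoly_parity altpoly_root // mulr0.
have [l ql] := entire_difference_quotient w (@altpoly_entire n).
pose rest v := \prod_(j < n | j != i) (v ^+ 2 - z j ^+ 2).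
have rest0 : rest w != 0.
  apply/prodf_neq0 => j ji; rewrite subr_eq0 wi; apply/eqP => /node_sqr_inj ij.
  by move: ji; rewrite -(inj_eq val_inj) /= ij eqxx.
exists (l * ((w + w) * rest w)^-1).
apply: (@pcvg_near _ (fun v =>
  (altpoly E F z n v - altpoly E F z n w) / (v - w) * ((v + w) * rest v)^-1)).
  apply: filterS2 (near_dnbhs_neq w) (near_node_product n w) => v vw pv.
  rewrite altdet_ratioE pw subr0.
  have -> : node_product n v = (v ^+ 2 - w ^+ 2) * rest v.
    by rewrite /node_product (bigD1 i) //= wi.
  by rewrite subr_sqr -!mulrA -!invfM mulrA.
apply: pcvgM => //; apply: pcvgV.
  by apply/eqP; rewrite mulf_neq0 // -mulr2n mulrn_eq0.
apply: pcvgM.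
  by apply: pcvgD; [exact: pcvg_id|exact: pcvg_cst].
have -> : rest = fun v => \prod_(j < n) (if j != i then v ^+ 2 - z j ^+ 2 else 1).
  by apply/funext => v; rewrite -big_mkcond.
apply: pcvg_prod => j; case: (j != i); last exact: pcvg_cst.
apply: pcvgB; last exact: pcvg_cst.
by rewrite expr2; under eq_fun do rewrite expr2; apply: pcvgM; exact: pcvg_id.
Qed.

Lemma altdet_ratio0 w : altdet_ratio z 0 E F w = E w.
Proof.
rewrite altdet_ratioE /node_product big_ord0 divr1 /altpoly.
by rewrite /altdet det_mx00 divr1 det_mx11 !mxE /= expr0 mul1r /nodes_and.
Qed.

(** The common shape of [calA] and [calB]. *)
Definition regularized (c : R[i]) n w :=
  if n is 0 then E w else extend (fun v => c * altdet_ratio z n E F v) w.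

Lemma regularized_cvg c n w : (n = 0%N -> c = 1) ->
  pcvg (fun v => c * altdet_ratio z n E F v) w (regularized c n w).
Proof.
case: n => [|n] c1 /=.
  rewrite c1 //; under eq_fun do rewrite altdet_ratio0 mul1r.
  exact: entire_continuous.
have [l rl] := altdet_ratio_ex_cvg n.+1 w.
have crl := pcvgM (pcvg_cst c w) rl.
by rewrite (pcvg_extend crl).
Qed.

Lemma regularizedE c n w : (n = 0%N -> c = 1) -> node_product n w != 0 ->
  regularized c n w = c * (altpoly E F z n w / node_product n w).
Proof.
move=> c1 pw; rewrite -altdet_ratioE; apply: pcvg_unique (regularized_cvg w c1) _.
by apply: pcvgM; [exact: pcvg_cst|exact: altdet_ratio_cvg].
Qed.

Lemma regularized_continuous c n w : (n = 0%N -> c = 1) ->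
  pcvg (regularized c n) w (regularized c n w).
Proof.
move=> c1; apply: pcvg_near (regularized_cvg w c1).
apply: filterS (near_node_product n w) => v pv.
by rewrite regularizedE // altdet_ratioE.
Qed.

Lemma regularized_node c n : (n = 0%N -> c = 1) -> c != 0 ->
  regularized c n (z n) <> 0.
Proof.
move=> c1 c0; have pn := node_product_node n; rewrite regularizedE //.
have p0 : altpoly E F z n (z n) != 0.
  apply/eqP => p0; apply: (@d_neq0 n.+1).
  by rewrite (altdet_nodesS (@d_neq0 n)) p0 mulr0.
by apply/eqP; apply: mulf_neq0 => //; apply: mulf_neq0 => //; rewrite invr_neq0.
Qed.

End Functions.
End Regularity.

(** * The recursion in the number of nodes, at a fixed parameter *)
Section DarbouxAlgebra.
Variables (R : realType) (z : nat -> R[i]).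
Hypotheses (z_imaginary : forall i, complex.Re (z i) = 0)
  (z_distinct : forall i j, i <> j -> z i <> z j)
  (z_not_opp : forall i j, z i <> - z j).
Variables (E F : R[i] -> R[i]) (s : R[i]).
Hypotheses (E_entire : entire E) (F_entire : entire F)
  (E_parity : forall w, E (- w) = s * E w)
  (F_parity : forall w, F (- w) = - s * F w)
  (dE_neq0 : forall n, altdet E F (nodes z n) <> 0)
  (dF_neq0 : forall n, altdet F E (nodes z n) <> 0).

(** This is [altpolyS] divided by [node_product]. It extends from generic [w]
to the earlier nodes by continuity of both sides. *)
Lemma regularizedS (n : nat) (c c' k : R[i]) (w : R[i]) :
  (n = 0%N -> c = 1) -> (n = 0%N -> c' = 1) -> c != 0 -> c' != 0 ->
  w ^+ 2 <> z n ^+ 2 ->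
  let a := regularized z E F c n in
  let b := regularized z F E c' n in
  regularized z E F k n.+1 w =
  k / c' * ((w ^+ 2 - z n ^+ 2)^-1 * (w * b w - z n * b (z n) / a (z n) * a w)).
Proof.
move=> c1 c1' c0 c0' wz a b.
have E_parity' v : E (- v) = - - s * E v by rewrite opprK.
have wz0 : w ^+ 2 - z n ^+ 2 <> 0 by move=> /eqP; rewrite subr_eq0 => /eqP.
have ck : n.+1 = 0%N -> k = 1 by [].
have ca v : pcvg a v (a v).
  exact: (regularized_continuous z_imaginary z_distinct z_not_opp
    E_entire F_entire E_parity F_parity dE_neq0).
have cb v : pcvg b v (b v).
  exact: (regularized_continuous z_imaginary z_distinct z_not_opp
    F_entire E_entire F_parity E_parity' dF_neq0).
have cS := regularized_continuous z_imaginary z_distinct z_not_opp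
  E_entire F_entire E_parity F_parity dE_neq0 w ck.
apply: pcvg_unique cS _.
apply: (@pcvg_near _ (fun v => k / c' * ((v ^+ 2 - z n ^+ 2)^-1 *
   (v * b v - z n * b (z n) / a (z n) * a v)))); last first.
  apply: pcvgM; first exact: pcvg_cst.
  apply: pcvgM.
    apply: pcvgV => //; apply: pcvgB; last exact: pcvg_cst.
    by rewrite expr2; under eq_fun do rewrite expr2; apply: pcvgM; exact: pcvg_id.
  apply: pcvgB; first by apply: pcvgM; [exact: pcvg_id|exact: cb].
  by apply: pcvgM; [exact: pcvg_cst|exact: ca].
apply: filterS (near_node_product z n.+1 w) => v pv1.
have := pv1; rewrite node_productS mulf_eq0 negb_or => /andP[pv vz].
have pz := node_product_node z_distinct z_not_opp n.
have aE u : node_product z n u != 0 ->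
    a u = c * (altpoly E F z n u / node_product z n u).
  exact: (regularizedE z_imaginary z_distinct z_not_opp E_entire F_entire
    E_parity F_parity dE_neq0).
have bE u : node_product z n u != 0 ->
    b u = c' * (altpoly F E z n u / node_product z n u).
  exact: (regularizedE z_imaginary z_distinct z_not_opp F_entire E_entire
    F_parity E_parity' dF_neq0).
rewrite (regularizedE z_imaginary z_distinct z_not_opp E_entire F_entire
    E_parity F_parity dE_neq0) //.
rewrite !aE ?bE // altpolyS // node_productS.
have p0 : altpoly E F z n (z n) != 0.
  by apply/eqP => p0; apply: (@dE_neq0 n.+1); rewrite altdet_nodesS // p0 mulr0.
by field; rewrite vz pv pz c0 c0' p0.
Qed.

End DarbouxAlgebra.

Definition signA (R : realType) n : R[i] := (-1) ^+ (n * (n - 1))./2.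
Definition signB (R : realType) n : R[i] := (-1) ^+ (n * (n + 1))./2.

Section Signs.
Variable R : realType.

Lemma signAS n : signA R n.+1 = signB R n.
Proof. by rewrite /signA /signB subn1 /= mulnC addn1. Qed.

Lemma signBS n : signB R n.+1 = - signA R n.
Proof.
have -> : signB R n.+1 = (-1) ^+ 'C(n.+2, 2).
  by rewrite /signB bin2 addn1 mulnC.
have -> : signA R n = (-1) ^+ 'C(n, 2) by rewrite /signA bin2 subn1.
rewrite binS bin1 binS bin1 -addnA exprD addnS exprS addnn -mul2n exprM.
by rewrite sqrrN expr1n expr1n; ring.
Qed.

Lemma signA_neq0 n : signA R n != 0.
Proof. by rewrite expf_neq0 // oppr_eq0 oner_eq0. Qed.

Lemma signB_neq0 n : signB R n != 0.
Proof. by rewrite expf_neq0 // oppr_eq0 oner_eq0. Qed.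

End Signs.

Section CalRegularized.
Variables (R : realType) (z : nat -> R[i]) (A B : R -> R[i] -> R[i]).

Lemma calA_regularized n x w :
  calA z A B n x w = regularized z (A x) (B x) (signA R n) n w.
Proof. by case: n. Qed.

Lemma calB_regularized n x w :
  calB z A B n x w = regularized z (B x) (A x) (signB R n) n w.
Proof. by case: n. Qed.

End CalRegularized.

(** * The Darboux transformation of the first-order system *)

Definition solves (R : realType) (m w : R[i]) (a b : R -> R[i]) (x : R) :=
  has_cderive a x (m * a x - w * b x) /\
  has_cderive b x (- (m * b x) + w * a x).

Section DarbouxStep.
Variable R : realType.
Implicit Types (a b f g : R -> R[i]) (x : R) (m w z : R[i]).

Lemma has_cderive_solution_ratio m z (az bz : R -> R[i]) x :
  az x <> 0 -> solves m z az bz x ->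
  has_cderive (fun t => bz t / az t) x
    (- 2 * m * (bz x / az x) + z * (1 + (bz x / az x) ^+ 2)).
Proof.
move=> az0 [daz dbz].
have := has_cderive_div az0 dbz daz; congr has_cderive.
by field; apply/eqP.
Qed.

(** A symmetry of the system under which statements on the first component
yield those on the second. *)
Lemma solves_opp m z (az bz : R -> R[i]) x :
  solves m z az bz x -> solves (- m) (- z) bz az x.
Proof.
move=> [da db]; split; first by move: db; rewrite !mulNr opprK.
by move: da; rewrite !mulNr opprK.
Qed.

Lemma darboux_step_component m w z (a b az bz : R -> R[i]) x :
  az x <> 0 -> bz x <> 0 -> w ^+ 2 <> z ^+ 2 ->
  solves m w a b x -> solves m z az bz x ->
  has_cderive
    (fun t => (w ^+ 2 - z ^+ 2)^-1 * (w * b t - z * (bz t / az t) * a t)) x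
    ((- m + z * (bz x / az x + az x / bz x)) *
       ((w ^+ 2 - z ^+ 2)^-1 * (w * b x - z * (bz x / az x) * a x))
     - w * (- ((w ^+ 2 - z ^+ 2)^-1 * (w * a x - z * (az x / bz x) * b x)))).
Proof.
move=> az0 bz0 wz [da db] sz.
have dr := has_cderive_solution_ratio az0 sz.
have wz0 : w ^+ 2 - z ^+ 2 != 0 by rewrite subr_eq0; apply/eqP.
move/eqP: az0 => az0; move/eqP: bz0 => bz0.
have := has_cderiveZ (w ^+ 2 - z ^+ 2)^-1
  (has_cderiveB (has_cderiveZ w db) (has_cderiveM (has_cderiveZ z dr) da)).
congr has_cderive; field.
by rewrite az0 bz0 wz0.
Qed.

(** A solution [(az, bz)] at the spectral value [z] transforms solutions at [w]
into solutions at [w] for the potential [- m + z (r + 1 / r)], where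
[r = bz / az] satisfies the Riccati equation [r' = - 2 m r + z (1 + r^2)]. *)
Lemma darboux_step m w z (a b az bz : R -> R[i]) x :
  az x <> 0 -> bz x <> 0 -> w ^+ 2 <> z ^+ 2 ->
  solves m w a b x -> solves m z az bz x ->
  solves (- m + z * (bz x / az x + az x / bz x)) w
    (fun t => (w ^+ 2 - z ^+ 2)^-1 * (w * b t - z * (bz t / az t) * a t))
    (fun t => - ((w ^+ 2 - z ^+ 2)^-1 * (w * a t - z * (az t / bz t) * b t))) x.
Proof.
move=> az0 bz0 wz s sz; split; first exact: darboux_step_component.
have wz' : (- w) ^+ 2 <> (- z) ^+ 2 by rewrite !sqrrN.
have := has_cderiveN
  (darboux_step_component bz0 az0 wz' (solves_opp s) (solves_opp sz)).
rewrite !sqrrN.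
have -> : (fun t => - ((w ^+ 2 - z ^+ 2)^-1 *
    (- w * a t - - z * (az t / bz t) * b t))) =
  (fun t => - - ((w ^+ 2 - z ^+ 2)^-1 * (w * a t - z * (az t / bz t) * b t))).
  by apply/funext => t; ring.
move=> /has_cderiveN; under eq_fun do rewrite opprK.
congr has_cderive; ring.
Qed.

(** Eliminating the derivatives by the system shows that the transformation of
[darboux_step] is the subtraction of the logarithmic derivative at [z]. *)
Lemma darboux_log_derivative_A m w z (a b az bz da daz : R[i]) :
  da = m * a - w * b -> daz = m * az - z * bz ->
  az <> 0 -> w ^+ 2 <> z ^+ 2 ->
  (w ^+ 2 - z ^+ 2)^-1 * (w * b - z * (bz / az) * a) =
  (z ^+ 2 - w ^+ 2)^-1 * (da - daz / az * a).
Proof.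
move=> -> -> /eqP az0 wz.
have w0 : w ^+ 2 - z ^+ 2 != 0 by rewrite subr_eq0; apply/eqP.
have w0' : z ^+ 2 - w ^+ 2 != 0 by rewrite -opprB oppr_eq0.
by field; rewrite w0 w0' az0.
Qed.

Lemma darboux_log_derivative_B m w z (a b az bz db dbz : R[i]) :
  db = - (m * b) + w * a -> dbz = - (m * bz) + z * az ->
  bz <> 0 -> w ^+ 2 <> z ^+ 2 ->
  - ((w ^+ 2 - z ^+ 2)^-1 * (w * a - z * (az / bz) * b)) =
  (z ^+ 2 - w ^+ 2)^-1 * (db - dbz / bz * b).
Proof.
move=> -> -> /eqP bz0 wz.
have w0 : w ^+ 2 - z ^+ 2 != 0 by rewrite subr_eq0; apply/eqP.
have w0' : z ^+ 2 - w ^+ 2 != 0 by rewrite -opprB oppr_eq0.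
by field; rewrite w0 w0' bz0.
Qed.

Lemma has_cderive_dlog f x d : has_cderive f x d -> dlog f x = d / f x.
Proof. by rewrite /dlog => -[_ ->]. Qed.

Lemma dlogM f g x d e : f x <> 0 -> g x <> 0 ->
  has_cderive f x d -> has_cderive g x e ->
  dlog (fun t => f t * g t) x = dlog f x + dlog g x.
Proof.
move=> f0 g0 df dg; rewrite (has_cderive_dlog (has_cderiveM df dg)).
rewrite (has_cderive_dlog df) (has_cderive_dlog dg).
by field; apply/andP; split; apply/eqP.
Qed.

Lemma dlogZ c f x d : c <> 0 -> has_cderive f x d ->
  dlog (fun t => c * f t) x = dlog f x.
Proof.
move=> /eqP c0 df; rewrite (has_cderive_dlog (has_cderiveZ c df)).
by rewrite (has_cderive_dlog df) invfM mulrACA divff // mul1r.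
Qed.

Lemma dlog_ext (U : set R) f g x d : open U -> U x ->
  (forall t, U t -> f t = g t) -> has_cderive f x d -> dlog f x = dlog g x.
Proof.
move=> oU Ux fg df; rewrite (has_cderive_dlog df) (fg _ Ux).
by rewrite (has_cderive_dlog (has_cderive_ext oU Ux fg df)).
Qed.

(** Hence the potential of [darboux_step] is [m] minus the logarithmic
derivative of [az / bz]. *)
Lemma dlog_solution_ratio m z (az bz : R -> R[i]) x :
  az x <> 0 -> bz x <> 0 -> solves m z az bz x ->
  dlog (fun t => az t / bz t) x =
  2 * m - z * (bz x / az x + az x / bz x).
Proof.
move=> az0 bz0 sz.
rewrite (has_cderive_dlog (has_cderive_solution_ratio bz0 (solves_opp sz))).
by field; apply/andP; split; apply/eqP.
Qed.

Lemma is_neg_dlog2_ext (U : set R) (tau tau' g g' : R -> R[i]) : open U ->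
  (forall x, U x -> tau x = tau' x) -> (forall x, U x -> g x = g' x) ->
  is_neg_dlog2 U tau g -> is_neg_dlog2 U tau' g'.
Proof.
move=> oU tt' gg' tg x Ux; have [t0 dt ddt gE] := tg x Ux.
have [dt' _] := has_cderive_ext oU Ux tt' (cderivable_has dt).
have ll' t : U t -> dlog tau t = dlog tau' t.
  by move=> Ut; have [_ dtt _ _] := tg t Ut;
    exact: dlog_ext oU Ut tt' (cderivable_has dtt).
have [ddt' E] := has_cderive_ext oU Ux ll' (cderivable_has ddt).
by split=> //; rewrite -?tt' -?gg' // E.
Qed.

(** With [r = bz / az] and [s = r + 1 / r], the logarithmic derivative of
[az * bz] is [z (1 / r - r)], and minus its derivative is [z s (z s - 2 m)]
by the Riccati equation. Adding [m ^ 2] completes the square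
[(- m + z s) ^ 2]. *)
Lemma is_neg_dlog2_darboux (U : set R) (tau m az bz : R -> R[i]) (z c : R[i]) :
  open U -> c <> 0 -> (forall x, U x -> az x <> 0 /\ bz x <> 0) ->
  (forall x, U x -> solves (m x) z az bz x) ->
  is_neg_dlog2 U tau (fun x => m x ^+ 2) ->
  is_neg_dlog2 U (fun t => c * (tau t * az t * bz t))
    (fun x => (- m x + z * (bz x / az x + az x / bz x)) ^+ 2).
Proof.
move=> oU c0 ab0 sz tm x Ux.
have cdt t : U t -> exists d, has_cderive (fun t => tau t * az t * bz t) t d.
  move=> Ut; have [_ dt _ _] := tm t Ut; have [da db] := sz t Ut.
  by eexists; exact: has_cderiveM (has_cderiveM (cderivable_has dt) da) db.
have lE t : U t -> dlog tau t + z * (az t / bz t - bz t / az t) =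
    dlog (fun t => c * (tau t * az t * bz t)) t.
  move=> Ut; have [d dt] := cdt t Ut; rewrite (dlogZ c0 dt).
  have [t0 dtau _ _] := tm t Ut; have [da db] := sz t Ut.
  have [a0 b0] := ab0 t Ut.
  have dta := has_cderiveM (cderivable_has dtau) da.
  have ta0 : tau t * az t <> 0.
    by apply/eqP; rewrite mulf_neq0 //; apply/eqP.
  rewrite (dlogM ta0 b0 dta db) (dlogM t0 a0 (cderivable_has dtau) da).
  rewrite (has_cderive_dlog da) (has_cderive_dlog db).
  by field; apply/andP; split; apply/eqP.
have [t0 dtau ddtau gE] := tm x Ux; have [a0 b0] := ab0 x Ux.
have [d dt] := cdt x Ux.
have [ctau _] := has_cderiveZ c dt.
have dr := has_cderive_solution_ratio a0 (sz x Ux).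
have dr' := has_cderive_solution_ratio b0 (solves_opp (sz x Ux)).
have dl := has_cderiveD (cderivable_has ddtau)
  (has_cderiveZ z (has_cderiveB dr' dr)).
have [dl1 dl2] := has_cderive_ext oU Ux lE dl.
split=> //.
  apply/eqP; rewrite !mulf_neq0 //; by apply/eqP.
have dlt : cderive (dlog tau) x = - (m x) ^+ 2 by rewrite gE opprK.
rewrite dl2 dlt; field.
by apply/andP; split; apply/eqP.
Qed.

End DarbouxStep.

(** * Wronskians as alternating determinants *)

(** A class of functions of the parameter that is closed under differentiation
on [U]; its members occur as the coefficients of iterated derivatives. *)
Inductive differential_polynomial (R : realType) (mu : R -> R) :
    (R -> R[i]) -> Prop :=
| DPcst c : differential_polynomial mu (fun=> c)
| DPmu k : differential_polynomial mu (fun t => (derive1n k mu t)%:C)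
| DPadd f g : differential_polynomial mu f -> differential_polynomial mu g ->
    differential_polynomial mu (fun t => f t + g t)
| DPmul f g : differential_polynomial mu f -> differential_polynomial mu g ->
    differential_polynomial mu (fun t => f t * g t).

Section Wronskian.
Variables (R : realType) (U : set R) (mu : R -> R).
Hypotheses (U_open : open U)
  (mu_smooth : forall (k : nat) (x : R), U x -> derivable (derive1n k mu) x 1).

Lemma differential_polynomial_derive f : differential_polynomial mu f ->
  exists f', differential_polynomial mu f' /\
    forall x, U x -> has_cderive f x (f' x).
Proof.
elim=> [c|k|{}f g df [f' [df' Df]] dg [g' [dg' Dg]]
  |{}f g df [f' [df' Df]] dg [g' [dg' Dg]]].
- by exists (fun=> 0); split=> [|x _]; [exact: DPcst|exact: has_cderive_cst].
- exists (fun t => (derive1n k.+1 mu t)%:C); split=> [|x Ux]; first exact: DPmu.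
  apply/has_cderiveP; split; last exact: is_derive_cst.
  rewrite derive1nS derive1E; exact: (DeriveDef (@mu_smooth k x Ux)).
- exists (fun t => f' t + g' t); split=> [|x Ux]; first exact: DPadd.
  by apply: has_cderiveD; [exact: Df|exact: Dg].
exists (fun t => f' t * g t + f t * g' t); split=> [|x Ux].
  by apply: DPadd; apply: DPmul.
by apply: has_cderiveM; [exact: Df|exact: Dg].
Qed.

Lemma has_cderive_sum n (f : 'I_n -> R -> R[i]) (d : 'I_n -> R[i]) x :
  (forall l, has_cderive (f l) x (d l)) ->
  has_cderive (fun t => \sum_(l < n) f l t) x (\sum_(l < n) d l).
Proof.
elim: n f d => [|n IH] f d fd.
  by rewrite big_ord0; under eq_fun do rewrite big_ord0; exact: has_cderive_cst.
rewrite big_ord_recr; under eq_fun do rewrite big_ord_recr.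
by apply: has_cderiveD => //; exact: IH.
Qed.

Variables (E F : R -> R[i] -> R[i]) (sigma : R[i]).
Hypotheses (sigma_neq0 : sigma != 0)
  (EF_system : forall x, U x -> forall w,
     has_cderive (fun t => E t w) x (sigma * ((mu x)%:C * E x w - w * F x w)) /\
     has_cderive (fun t => F t w) x (sigma * (- ((mu x)%:C * F x w) + w * E x w))).

(** The sign [sigma] covers both orders of the pair: [1] for [(A, B)] and [- 1]
for [(B, A)]. *)
Lemma has_cderive_alt_term k w x : U x ->
  has_cderive (fun t => alt_term (E t) (F t) k w) x
    (sigma * (-1) ^+ k * ((mu x)%:C * alt_term (E x) (F x) k w
                          - alt_term (E x) (F x) k.+1 w)).
Proof.
move=> /EF_system /(_ w)[dE dF]; rewrite /alt_term /= -signr_odd exprSr.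
case: (odd k) => /=.
  by have := has_cderiveZ (w ^+ k) dF; congr has_cderive; rewrite expr1; ring.
by have := has_cderiveZ (w ^+ k) dE; congr has_cderive; rewrite expr0; ring.
Qed.

(** By [has_cderive_alt_term] one more derivative raises the degree in [w] by
one. The leading coefficient is a product of signs and powers of [sigma],
hence a constant, and no coefficient depends on [w]. *)
Lemma iter_cderive_alt_terms k : exists (T : nat -> R -> R[i]) (s : R[i]),
  [/\ forall l, differential_polynomial mu (T l), s != 0, forall x, T k x = s
    & forall x, U x -> forall w, iter k (@cderive R) (fun t => E t w) x =
        \sum_(l < k.+1) T l x * alt_term (E x) (F x) l w].
Proof.
elim: k => [|k [T [s [dT s0 Tk TE]]]].
  exists (fun _ _ => 1), 1; split=> //; first by move=> _; exact: DPcst.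
  by move=> x _ w; rewrite big_ord1 /alt_term /= expr0 !mul1r.
have /choice[T' T'P] := fun l => differential_polynomial_derive (dT l).
pose stay l x := T' l x + sigma * (-1) ^+ l * ((mu x)%:C * T l x).
pose move l x : R[i] :=
  if l is l'.+1 then - (sigma * (-1) ^+ l') * T l' x else 0.
exists (fun l x => (if (l <= k)%N then stay l x else 0) + move l x).
exists (- (sigma * (-1) ^+ k) * s); split.
- move=> l; apply: DPadd.
    case: (l <= k)%N; last exact: DPcst.
    apply: DPadd; first by have [] := T'P l.
    apply: DPmul; first exact: DPcst.
    by apply: DPmul => //; exact: (DPmu mu 0).
  case: l => [|l]; first exact: DPcst.
  by apply: DPmul => //; exact: DPcst.
- by rewrite mulf_neq0 // oppr_eq0 mulf_neq0 // expf_neq0 // oppr_eq0 oner_eq0.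
- by move=> x; rewrite ltnn add0r /move Tk.
move=> x Ux w; rewrite iterS.
have D : has_cderive (fun t => \sum_(l < k.+1) T l t * alt_term (E t) (F t) l w) x
    (\sum_(l < k.+1) (T' l x * alt_term (E x) (F x) l w +
       T l x * (sigma * (-1) ^+ l * ((mu x)%:C * alt_term (E x) (F x) l w
                          - alt_term (E x) (F x) l.+1 w)))).
  apply: has_cderive_sum => l; apply: has_cderiveM; last exact: has_cderive_alt_term.
  by have [_] := T'P l; apply.
have TE' t : U t -> \sum_(l < k.+1) T l t * alt_term (E t) (F t) l w =
    iter k (@cderive R) (fun t => E t w) t by move=> Ut; rewrite TE.
have [_ ->] := has_cderive_ext U_open Ux TE' D.
under [RHS]eq_bigr do rewrite mulrDl.
rewrite [RHS]big_split /= [X in _ = X + _]big_ord_recr /= ltnn mul0r addr0.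
rewrite [X in _ = _ + X]big_ord_recl /= mul0r add0r -big_split /=.
apply: eq_bigr => l _; rewrite -ltnS ltn_ord /stay; ring.
Qed.

(** By [iter_cderive_alt_terms] the two matrices differ by a lower triangular
factor with a constant diagonal. *)
Lemma wronskian_altdet (z : nat -> R[i]) n : exists2 s : R[i], s != 0 &
  forall x, U x -> Wz z E n x = s * altdet (E x) (F x) (nodes z n).
Proof.
have /choice[T TP] := iter_cderive_alt_terms.
have /choice[s sP] := TP.
exists (\prod_(k < n) s k).
  by apply/prodf_neq0 => k _; have [] := sP k.
move=> x Ux; rewrite /Wz /wronskian /altdet.
pose L : 'M[R[i]]_n := \matrix_(k, l) (if (l <= k)%N then T k l x else 0).
have -> : \prod_(k < n) s k = \det L.
  rewrite det_trig; last first.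
    by apply/is_trig_mxP => k l kl; rewrite mxE leqNgt kl.
  by apply: eq_bigr => k _; rewrite mxE leqnn; have [_ _ ->] := sP k.
rewrite -det_mulmx; congr (\det _); apply/matrixP => k j; rewrite !mxE.
have [_ _ _ ->] := sP k; last exact: Ux.
rewrite (big_ord_widen_cond n predT
  (fun l => T k l x * alt_term (E x) (F x) l (z j))) //.
rewrite big_mkcond /=; apply: eq_bigr => l _; rewrite !mxE ltnS.
by case: leqP => // _; rewrite mul0r.
Qed.

End Wronskian.

(** * The chain of modified spaces *)
Section Chain.
Variables (R : realType) (U : set R) (H : R -> hilbert_entire R)
    (A B : R -> R[i] -> R[i]) (mu : R -> R)
    (Z : R -> R[i] -> R[i] -> R[i]) (z : nat -> R[i]).
Hypotheses (U_open : open U)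
    (mu_smooth : forall (k : nat) (x : R), U x -> derivable (derive1n k mu) x 1)
    (A_entire : forall x, U x -> entire (A x))
    (A_even : forall x, U x -> forall w, A x (- w) = A x w)
    (B_entire : forall x, U x -> entire (B x))
    (B_odd : forall x, U x -> forall w, B x (- w) = - B x w)
    (Z_evaluator : forall x, U x -> forall v, is_evaluator (H x) v (Z x v))
    (Z_formula : forall x, U x -> forall v w, w <> v^* ->
       Z x v w = 2 * (((B x v)^* * A x w - (A x v)^* * B x w) / (v^* - w)))
    (AB_system : first_order_system U (fun x => (mu x)%:C) A B)
    (z_imaginary : forall i, complex.Re (z i) = 0)
    (z_distinct : forall i j, i <> j -> z i <> z j)
    (z_not_opp : forall i j, z i <> - z j)
    (z_indep : forall x, U x -> lin_indep (fun i => Z x (z i))).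

Local Notation a := (calA z A B).
Local Notation b := (calB z A B).

Let A_parity x (Ux : U x) w : A x (- w) = 1 * A x w.
Proof. by rewrite A_even // mul1r. Qed.

Let B_parity x (Ux : U x) w : B x (- w) = - 1 * B x w.
Proof. by rewrite B_odd // mulN1r. Qed.

Let A_parity' x (Ux : U x) w : A x (- w) = - - 1 * A x w.
Proof. by rewrite opprK A_parity. Qed.

Let dA x (Ux : U x) n : altdet (A x) (B x) (nodes z n) <> 0.
Proof.
exact: (altdet_AB_neq0 (@A_entire x Ux) (@B_entire x Ux) (A_even Ux) (B_odd Ux)
  (Z_evaluator Ux) (Z_formula Ux) z_imaginary z_distinct z_not_opp (z_indep Ux)).
Qed.

Let dB x (Ux : U x) n : altdet (B x) (A x) (nodes z n) <> 0.
Proof.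
exact: (altdet_BA_neq0 (@A_entire x Ux) (@B_entire x Ux) (A_even Ux) (B_odd Ux)
  (Z_evaluator Ux) (Z_formula Ux) z_imaginary z_distinct z_not_opp (z_indep Ux)).
Qed.

Let signA1 n : n = 0%N -> signA R n = 1.
Proof. by move=> ->. Qed.

Let signB1 n : n = 0%N -> signB R n = 1.
Proof. by move=> ->. Qed.

Lemma calA_node n x : U x -> calA z A B n x (z n) <> 0.
Proof.
move=> Ux; rewrite calA_regularized.
exact: (regularized_node z_imaginary z_distinct z_not_opp (@A_entire x Ux)
  (@B_entire x Ux) (A_parity Ux) (B_parity Ux) (dA Ux) (@signA1 n) (signA_neq0 R n)).
Qed.

Lemma calB_node n x : U x -> calB z A B n x (z n) <> 0.
Proof.
move=> Ux; rewrite calB_regularized.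
exact: (regularized_node z_imaginary z_distinct z_not_opp (@B_entire x Ux)
  (@A_entire x Ux) (B_parity Ux) (A_parity' Ux) (dB Ux) (@signB1 n)
  (signB_neq0 R n)).
Qed.

Lemma calA_continuous n x w : U x -> pcvg (calA z A B n x) w (calA z A B n x w).
Proof.
move=> Ux; have -> : calA z A B n x = regularized z (A x) (B x) (signA R n) n.
  by apply/funext => v; rewrite calA_regularized.
exact: (regularized_continuous z_imaginary z_distinct z_not_opp (@A_entire x Ux)
  (@B_entire x Ux) (A_parity Ux) (B_parity Ux) (dA Ux) w (@signA1 n)).
Qed.

Lemma calB_continuous n x w : U x -> pcvg (calB z A B n x) w (calB z A B n x w).
Proof.
move=> Ux; have -> : calB z A B n x = regularized z (B x) (A x) (signB R n) n.
  by apply/funext => v; rewrite calB_regularized.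
exact: (regularized_continuous z_imaginary z_distinct z_not_opp (@B_entire x Ux)
  (@A_entire x Ux) (B_parity Ux) (A_parity' Ux) (dB Ux) w (@signB1 n)).
Qed.

Lemma calAS n x w : U x -> w ^+ 2 <> z n ^+ 2 ->
  calA z A B n.+1 x w = (w ^+ 2 - z n ^+ 2)^-1 *
    (w * b n x w - z n * (b n x (z n) / a n x (z n)) * a n x w).
Proof.
move=> Ux wz; rewrite !(calA_regularized, calB_regularized).
rewrite (regularizedS z_imaginary z_distinct z_not_opp (@A_entire x Ux)
  (@B_entire x Ux) (A_parity Ux) (B_parity Ux) (dA Ux) (dB Ux)
  (signA R n.+1) (@signA1 n) (@signB1 n) (signA_neq0 R n) (signB_neq0 R n) wz).
by rewrite signAS divff ?signB_neq0 // mul1r !mulrA.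
Qed.

Lemma calBS n x w : U x -> w ^+ 2 <> z n ^+ 2 ->
  calB z A B n.+1 x w = - ((w ^+ 2 - z n ^+ 2)^-1 *
    (w * a n x w - z n * (a n x (z n) / b n x (z n)) * b n x w)).
Proof.
move=> Ux wz; rewrite !(calA_regularized, calB_regularized).
rewrite (regularizedS z_imaginary z_distinct z_not_opp (@B_entire x Ux)
  (@A_entire x Ux) (B_parity Ux) (A_parity' Ux) (dB Ux) (dA Ux)
  (signB R n.+1) (@signB1 n) (@signA1 n) (signB_neq0 R n) (signA_neq0 R n) wz).
by rewrite signBS mulNr divff ?signA_neq0 // mulN1r !mulrA.
Qed.

(** The potentials produced by iterating [darboux_step]; [Wz_quotient]
identifies them with [mu_n]. *)
Fixpoint potential n t : R[i] :=
  if n is n'.+1 then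
    - potential n' t + z n' * (b n' t (z n') / a n' t (z n')
                               + a n' t (z n') / b n' t (z n'))
  else (mu t)%:C.

(** For [w ^+ 2 <> z n ^+ 2] this is [darboux_step]. At [w = z n] and
[w = - z n], where [calA n.+1] and [calB n.+1] are defined by removing a
singularity, the system passes to the limit in [w] by [system_limit]. *)
Lemma potential_system n :
  (forall x, U x -> cderivable (potential n) x) /\
  (forall x, U x -> forall w, solves (potential n x) w (a n ^~ w) (b n ^~ w) x).
Proof.
elim: n => [|n [dm IH]].
  split=> [x Ux|x Ux w]; first by apply: cderivable_real; exact: (@mu_smooth 0 x Ux).
  have [cA cB eA eB] := AB_system Ux w.
  split; [apply: (conj cA)|apply: (conj cB)].
    rewrite -[LHS]/(cderive (fun t => A t w) x).
    rewrite -[LHS](subrK ((mu x)%:C * A x w)) eA /=.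
    by rewrite addrC mulNr.
  rewrite -[LHS]/(cderive (fun t => B t w) x).
  by rewrite -[LHS](addrK ((mu x)%:C * B x w)) eB /= addrC.
have dm' x : U x -> cderivable (potential n.+1) x.
  move=> Ux; have s := IH x Ux (z n).
  have r1 := has_cderive_solution_ratio (@calA_node n x Ux) s.
  have r2 := has_cderive_solution_ratio (@calB_node n x Ux) (solves_opp s).
  have := has_cderiveD (has_cderiveN (cderivable_has (dm x Ux)))
    (has_cderiveZ (z n) (has_cderiveD r1 r2)).
  by case.
split=> //.
have generic x w : U x -> w ^+ 2 <> z n ^+ 2 ->
    solves (potential n.+1 x) w (a n.+1 ^~ w) (b n.+1 ^~ w) x.
  move=> Ux wz.
  have [sa sb] := darboux_step (@calA_node n x Ux) (@calB_node n x Ux) wz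
    (IH x Ux w) (IH x Ux (z n)).
  split.
    rewrite calAS // calBS //; apply: has_cderive_ext U_open Ux _ sa.
    by move=> t Ut; rewrite calAS.
  rewrite calAS // calBS //; apply: has_cderive_ext U_open Ux _ sb.
  by move=> t Ut; rewrite calBS.
move=> x Ux w; have [wz|/eqP wz] := eqVneq (w ^+ 2) (z n ^+ 2); last exact: generic.
apply: (@system_limit _ _ (dnbhs (w : R[i]^o)) _ U (potential n.+1) id
  (fun v t => a n.+1 t v) (fun v t => b n.+1 t v) w) => //.
- exact: pcvg_id.
- by move=> t Ut; split; [exact: calA_continuous|exact: calB_continuous].
apply: filterS (near_node_product z n.+1 w) => v.
rewrite node_productS mulf_eq0 negb_or => /andP[_ vz] t Ut.
by apply: generic => //; apply/eqP; rewrite -subr_eq0.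
Qed.

(** Adding a node multiplies [altdet] by the value of [altpoly] at it; the
constant collects the signs and the value of [node_product]. *)
Lemma Wz_step (E F : R -> R[i] -> R[i]) (sigma c : R[i]) n :
  sigma != 0 -> c != 0 ->
  (forall x, U x -> forall w,
     has_cderive (fun t => E t w) x (sigma * ((mu x)%:C * E x w - w * F x w)) /\
     has_cderive (fun t => F t w) x (sigma * (- ((mu x)%:C * F x w) + w * E x w))) ->
  (forall x, U x -> forall n, altdet (E x) (F x) (nodes z n) <> 0) ->
  (forall x, U x -> regularized z (E x) (F x) c n (z n) =
     c * (altpoly (E x) (F x) z n (z n) / node_product z n (z n))) ->
  exists2 k : R[i], k != 0 & forall x, U x ->
    Wz z E n.+1 x = k * (Wz z E n x * regularized z (E x) (F x) c n (z n)).
Proof.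
move=> s0 c0 sys d0 rE.
have [s sn0 sE] := wronskian_altdet U_open mu_smooth s0 sys z n.
have [s' sn0' sE'] := wronskian_altdet U_open mu_smooth s0 sys z n.+1.
have pz := node_product_node z_distinct z_not_opp n.
exists (s' / s * (node_product z n (z n) / c)).
  by rewrite !mulf_neq0 ?invr_eq0.
move=> x Ux; rewrite sE // sE' // rE // (altdet_nodesS (d0 x Ux n)).
by field; rewrite sn0 pz c0.
Qed.

Let A_system x : U x -> forall w,
  has_cderive (fun t => A t w) x (1 * ((mu x)%:C * A x w - w * B x w)) /\
  has_cderive (fun t => B t w) x (1 * (- ((mu x)%:C * B x w) + w * A x w)).
Proof.
move=> Ux w; have [_ s] := potential_system 0; have := s x Ux w.
by rewrite !mul1r.
Qed.

Let B_system x : U x -> forall w,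
  has_cderive (fun t => B t w) x (- 1 * ((mu x)%:C * B x w - w * A x w)) /\
  has_cderive (fun t => A t w) x (- 1 * (- ((mu x)%:C * A x w) + w * B x w)).
Proof.
move=> Ux w; have [dA' dB'] := A_system Ux w.
by split; [move: dB'|move: dA']; congr has_cderive; ring.
Qed.

Lemma WzA_step n : exists2 k : R[i], k != 0 & forall x, U x ->
  Wz z A n.+1 x = k * (Wz z A n x * calA z A B n x (z n)).
Proof.
have [x Ux|k k0 kE] := Wz_step (n := n) (oner_neq0 _) (signA_neq0 R n) A_system dA.
- exact: (regularizedE z_imaginary z_distinct z_not_opp (@A_entire x Ux)
    (@B_entire x Ux) (A_parity Ux) (B_parity Ux) (dA Ux)
    (@signA1 n) (node_product_node z_distinct z_not_opp n)).
by exists k => // x Ux; rewrite kE // calA_regularized.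
Qed.

Let N1_neq0 : - 1 != 0 :> R[i].
Proof. by rewrite oppr_eq0 oner_eq0. Qed.

Lemma WzB_step n : exists2 k : R[i], k != 0 & forall x, U x ->
  Wz z B n.+1 x = k * (Wz z B n x * calB z A B n x (z n)).
Proof.
have [x Ux|k k0 kE] := Wz_step (n := n) N1_neq0 (signB_neq0 R n) B_system dB.
- exact: (regularizedE z_imaginary z_distinct z_not_opp (@B_entire x Ux)
    (@A_entire x Ux) (B_parity Ux) (A_parity' Ux) (dB Ux)
    (@signB1 n) (node_product_node z_distinct z_not_opp n)).
by exists k => // x Ux; rewrite kE // calB_regularized.
Qed.

Lemma Wz_scale c n : c != 0 -> exists2 k : R[i], k != 0 & forall x, U x ->
  Wz z (fun t w => c * B t w) n x = k * Wz z B n x.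
Proof.
move=> c0.
have sys x : U x -> forall w,
    has_cderive (fun t => c * B t w) x
      (- 1 * ((mu x)%:C * (c * B x w) - w * (c * A x w))) /\
    has_cderive (fun t => c * A t w) x
      (- 1 * (- ((mu x)%:C * (c * A x w)) + w * (c * B x w))).
  move=> Ux w; have [dB' dA'] := B_system Ux w.
  by split; [move: (has_cderiveZ c dB')|move: (has_cderiveZ c dA')];
    congr has_cderive; ring.
have [s s0 sE] := wronskian_altdet U_open mu_smooth N1_neq0 sys z n.
have [s' s0' sE'] := wronskian_altdet U_open mu_smooth N1_neq0 B_system z n.
exists (s * c ^+ n / s'); first by rewrite !mulf_neq0 ?expf_neq0 ?invr_eq0.
move=> x Ux; rewrite sE // sE' //.
have -> : altdet (fun w => c * B x w) (fun w => c * A x w) (nodes z n) =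
    c ^+ n * altdet (B x) (A x) (nodes z n).
  rewrite /altdet -detZ; congr (\det _); apply/matrixP => k j; rewrite !mxE.
  by case: odd; ring.
by field.
Qed.

(** By [WzA_step] and [WzB_step] the quotient of Wronskians is, up to a
constant, the product of the quotients [calA k / calB k] at [z k], and each
of them shifts the potential by [dlog_solution_ratio]. *)
Lemma Wz_quotient n :
  (forall x, U x ->
    [/\ Wz z A n x <> 0, Wz z B n x <> 0
      & cderivable (fun t => Wz z A n t / Wz z B n t) x]) /\
  (forall x, U x -> mu_n z A B mu n x = potential n x).
Proof.
elim: n => [|n [IH1 IH2]].
  have W0 (f : R -> R[i] -> R[i]) t : Wz z f 0 t = 1.
    by rewrite /Wz /wronskian det_mx00.
  split=> x Ux.
    rewrite !W0; split; try by apply/eqP; rewrite oner_eq0.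
    by under eq_fun do rewrite !W0; have [] := has_cderive_cst x (1 / 1 : R[i]).
  rewrite /mu_n; under eq_fun do rewrite !W0.
  by rewrite (has_cderive_dlog (has_cderive_cst x _)) mul0r subr0.
have [k k0 kE] := WzA_step n; have [l l0 lE] := WzB_step n.
have [_ sys] := potential_system n.
have QE t : U t -> k / l * (Wz z A n t / Wz z B n t * (a n t (z n) / b n t (z n))) =
    Wz z A n.+1 t / Wz z B n.+1 t.
  move=> Ut; have [/eqP WA /eqP WB _] := IH1 t Ut; rewrite kE // lE //.
  have /eqP a0 := @calA_node n t Ut; have /eqP b0 := @calB_node n t Ut.
  by field; rewrite l0 WB b0.
have kl0 : k / l <> 0 by apply/eqP; rewrite mulf_neq0 // invr_eq0.
have dQ t (Ut : U t) := cderivable_has (let: And3 _ _ c := IH1 t Ut in c).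
have dr t (Ut : U t) := has_cderive_solution_ratio (@calB_node n t Ut)
  (solves_opp (sys t Ut (z n))).
split=> x Ux; have [/eqP WA /eqP WB _] := IH1 x Ux.
  have /eqP a0 := @calA_node n x Ux; have /eqP b0 := @calB_node n x Ux.
  split.
  - by rewrite kE //; apply/eqP; exact: mulf_neq0 k0 (mulf_neq0 WA a0).
  - by rewrite lE //; apply/eqP; exact: mulf_neq0 l0 (mulf_neq0 WB b0).
  have := has_cderiveZ (k / l) (has_cderiveM (dQ x Ux) (dr x Ux)).
  by move=> /(has_cderive_ext U_open Ux QE)[].
have d1 := has_cderiveM (dQ x Ux) (dr x Ux).
rewrite /mu_n -(dlog_ext U_open Ux QE (has_cderiveZ (k / l) d1)) (dlogZ kl0 d1).
rewrite (dlogM _ _ (dQ x Ux) (dr x Ux)).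
- rewrite (dlog_solution_ratio (@calA_node n x Ux) (@calB_node n x Ux)
    (sys x Ux (z n))).
  have := IH2 x Ux; rewrite /mu_n /=.
  move: (dlog _ _) (potential n x) (a n x (z n)) (b n x (z n)) => d m a' b' <-.
  ring.
- by apply/eqP; apply: mulf_neq0 => //; rewrite invr_eq0.
apply/eqP; apply: mulf_neq0; first by apply/eqP; exact: calA_node.
by rewrite invr_eq0; apply/eqP; exact: calB_node.
Qed.

Lemma tau_n_neg_dlog2 (tau : R -> R[i]) :
  is_neg_dlog2 U tau (fun x => (mu x)%:C ^+ 2) ->
  forall n, is_neg_dlog2 U (tau_n z A B tau n) (fun x => potential n x ^+ 2).
Proof.
move=> tau0; elim=> [|n IH].
  apply: is_neg_dlog2_ext tau0 => // x Ux.
  by rewrite /tau_n /Wz /wronskian !det_mx00 !mulr1.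
have i0 : - 'i%C != 0 :> R[i] by rewrite oppr_eq0 eq_complex /= oner_eq0 andbF.
have [k k0 kE] := WzA_step n; have [l l0 lE] := WzB_step n.
have [p p0 pE] := Wz_scale n i0; have [q q0 qE] := Wz_scale n.+1 i0.
have [_ sys] := potential_system n.
have c0 : k * l * q / p <> 0 by apply/eqP; rewrite !mulf_neq0 ?invr_eq0.
have ab0 x : U x -> a n x (z n) <> 0 /\ b n x (z n) <> 0.
  by move=> Ux; split; [exact: calA_node|exact: calB_node].
have := is_neg_dlog2_darboux U_open c0 ab0 (fun x Ux => sys x Ux (z n)) IH.
apply: is_neg_dlog2_ext => // x Ux.
by rewrite /tau_n pE // qE // kE // lE //; field.
Qed.

End Chain.

Theorem theorem9 (R : realType) (U : set R) (H : R -> hilbert_entire R)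
    (A B : R -> R[i] -> R[i]) (mu : R -> R)
    (Z : R -> R[i] -> R[i] -> R[i]) (z : nat -> R[i])
    (U_open : open U)
    (mu_smooth : forall (k : nat) (x : R), U x -> derivable (derive1n k mu) x 1)
    (A_entire : forall x, U x -> entire (A x))
    (A_even : forall x, U x -> forall w, A x (- w) = A x w)
    (A_real : forall x, U x -> real_on_real (A x))
    (B_entire : forall x, U x -> entire (B x))
    (B_odd : forall x, U x -> forall w, B x (- w) = - B x w)
    (B_real : forall x, U x -> real_on_real (B x))
    (Z_evaluator : forall x, U x -> forall v, is_evaluator (H x) v (Z x v))
    (Z_formula : forall x, U x -> forall v w, w <> v^* ->
       Z x v w = 2 * (((B x v)^* * A x w - (A x v)^* * B x w) / (v^* - w)))
    (AB_system : first_order_system U (fun x => (mu x)%:C) A B)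
    (z_imaginary : forall i, complex.Re (z i) = 0)
    (z_distinct : forall i j, i <> j -> z i <> z j)
    (z_not_opp : forall i j, z i <> - z j)
    (z_indep : forall x, U x -> lin_indep (fun i => Z x (z i))) :
  (forall (n : nat) (x : R), U x ->
     [/\ calA z A B n x (z n) <> 0,
         calB z A B n x (z n) <> 0
       & forall w : R[i], w ^+ 2 <> z n ^+ 2 ->
           calA z A B n.+1 x w =
             (z n ^+ 2 - w ^+ 2)^-1 *
             (cderive (fun t => calA z A B n t w) x
              - cderive (fun t => calA z A B n t (z n)) x
                / calA z A B n x (z n) * calA z A B n x w)
           /\
           calB z A B n.+1 x w =
             (z n ^+ 2 - w ^+ 2)^-1 *
             (cderive (fun t => calB z A B n t w) x
              - cderive (fun t => calB z A B n t (z n)) x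
                / calB z A B n x (z n) * calB z A B n x w)])
  /\
  (forall n : nat,
     (forall x, U x ->
        [/\ Wz z A n x <> 0, Wz z B n x <> 0
          & cderivable (fun t => Wz z A n t / Wz z B n t) x])
     /\ first_order_system U (mu_n z A B mu n) (calA z A B n) (calB z A B n))
  /\
  (forall tau : R -> R[i],
     is_neg_dlog2 U tau (fun x => (mu x)%:C ^+ 2) ->
     forall n : nat,
       is_neg_dlog2 U (tau_n z A B tau n) (fun x => mu_n z A B mu n x ^+ 2)).
Proof.
have sys := potential_system U_open mu_smooth A_entire A_even B_entire B_odd
  Z_evaluator Z_formula AB_system z_imaginary z_distinct z_not_opp z_indep.
have a0 n x := @calA_node R U H A B Z z A_entire A_even B_entire B_odd
  Z_evaluator Z_formula z_imaginary z_distinct z_not_opp z_indep n x.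
have b0 n x := @calB_node R U H A B Z z A_entire A_even B_entire B_odd
  Z_evaluator Z_formula z_imaginary z_distinct z_not_opp z_indep n x.
have W n := @Wz_quotient R U H A B mu Z z U_open mu_smooth A_entire A_even
  B_entire B_odd Z_evaluator Z_formula AB_system z_imaginary z_distinct
  z_not_opp z_indep n.
split; last split.
- move=> n x Ux; split; [exact: a0|exact: b0|move=> w wz].
  have [_ s] := sys n.
  have cdA v : cderive (fun t => calA z A B n t v) x =
      potential A B mu z n x * calA z A B n x v - v * calB z A B n x v.
    by have [[]] := s x Ux v.
  have cdB v : cderive (fun t => calB z A B n t v) x =
      - (potential A B mu z n x * calB z A B n x v) + v * calA z A B n x v.
    by have [_ []] := s x Ux v.
  split.
    rewrite (calAS A_entire A_even B_entire B_odd Z_evaluator Z_formula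
      z_imaginary z_distinct z_not_opp z_indep Ux wz).
    exact: darboux_log_derivative_A (cdA w) (cdA (z n)) (a0 n x Ux) wz.
  rewrite (calBS A_entire A_even B_entire B_odd Z_evaluator Z_formula
    z_imaginary z_distinct z_not_opp z_indep Ux wz).
  exact: darboux_log_derivative_B (cdB w) (cdB (z n)) (b0 n x Ux) wz.
- move=> n; have [W1 W2] := W n; split=> // x Ux w.
  have [_ s] := sys n; have [[ca ea] [cb eb]] := s x Ux w.
  have moveA (u m p q : R[i]) : u = m * p - w * q -> u - m * p = - w * q.
    by move=> ->; ring.
  have moveB (u m p q : R[i]) : u = - (m * q) + w * p -> u + m * q = w * p.
    by move=> ->; ring.
  rewrite (W2 x Ux).
  split.
  - exact: ca.
  - exact: cb.
  - exact: (moveA _ _ _ _ ea).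
  - exact: (moveB _ _ _ _ eb).
move=> tau tau0 n.
have := tau_n_neg_dlog2 U_open mu_smooth A_entire A_even B_entire B_odd
  Z_evaluator Z_formula AB_system z_imaginary z_distinct z_not_opp z_indep
  tau0 n.
apply: is_neg_dlog2_ext => // x Ux; have [_ W2] := W n.
by rewrite W2.
Qed.
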